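(* Fix $\alpha>0$ and let $\mathcal R_0,\mathcal V_{\mathsf z},\mathcal V_{\mathsf u},\mathcal E$ satisfy $(\mathrm R_0)$, $(\mathrm V_z)$, $(\mathrm V_u)$, $(\mathrm E)$ (all spelled out in the context). Let $S>0$ and let $(\mathsf t,\mathsf q)\in \mathrm{AC}([0,S];[0,T]\times\mathcal Q)$, $\mathsf q=(\mathsf u,\mathsf z)$, with $\mathsf t$ nondecreasing. Then $(\mathsf t,\mathsf q)$ is a non-degenerate parameterized Balanced Viscosity solution to the rate-independent system $(\mathcal Q,\mathcal E,\mathcal R_0+\varepsilon\mathcal V_{\mathsf z}+\varepsilon^\alpha\mathcal V_{\mathsf u})$ if and only if $\mathsf t'+|\mathsf q'|>0$ a.e. in $(0,S)$ and there exist two Borel functions $\theta_{\mathsf u},\theta_{\mathsf z}:[0,S]\to[0,1]$ such that for almost all $s\in(0,S)$ $$\theta_{\mathsf u}(s)\,\mathbb V_{\mathsf u}(\mathsf q(s))\mathsf u'(s)+(1-\theta_{\mathsf u}(s))\,\mathrm D_u\mathcal E(\mathsf t(s),\mathsf u(s),\mathsf z(s))=0,$$ $$(1-\theta_{\mathsf z}(s))\,\partial\mathcal R_0(\mathsf q(s),\mathsf z'(s))+\theta_{\mathsf z}(s)\,\mathbb V_{\mathsf z}(\mathsf q(s))\mathsf z'(s)+(1-\theta_{\mathsf z}(s))\,\mathrm D_z\mathcal E(\mathsf t(s),\mathsf u(s),\mathsf z(s))\ni 0,$$ $$\mathsf t'(s)\,\theta_{\mathsf u}(s)=\mathsf t'(s)\,\theta_{\mathsf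 z}(s)=0,$$ together with the following additional condition, for almost all $s\in(0,S)$: - if $\alpha>1$: $\theta_{\mathsf u}(s)(1-\theta_{\mathsf z}(s))=0$; - if $\alpha=1$: $\theta_{\mathsf u}(s)=\theta_{\mathsf z}(s)$; - if $\alpha\in(0,1)$: $\theta_{\mathsf z}(s)(1-\theta_{\mathsf u}(s))=0$.
   Context: Let $T>0$, $\mathcal Q=\mathbb R^n\times\mathbb R^m$, $q=(u,z)\in\mathcal Q$; velocities are written $q'=(u',z')$ and forces $\xi=(\eta,\zeta)\in\mathbb R^{n+m}$, with $\eta\in\mathbb R^n$, $\zeta\in\mathbb R^m$. $|\cdot|$ and $\langle\cdot,\cdot\rangle$ are Euclidean norm and scalar product. $\mathrm{AC}$ denotes absolutely continuous curves. We write $\mathcal E(t,q)=\mathcal E(t,u,z)$. Assumptions: $(\mathrm R_0)$: $\mathcal R_0\in C^0(\mathcal Q\times\mathbb R^m)$; for every $q$, $\mathcal R_0(q,\cdot)$ is convex and positively homogeneous of degree 1; there are $C_{0,R},C_{1,R}>0$ with $C_{0,R}|z'|\le\mathcal R_0(q,z')\le C_{1,R}|z'|$ for all $(q,z')$. $(\mathrm V_z)$: $\mathcal V_{\mathsf z}(q;z')=\frac12\langle\mathbb V_{\mathsf z}(q)z',z'\rangle$ with $\mathbb V_{\mathsf z}\in C^0(\mathcal Q;\mathbb R^{m\times m})$ symmetric-matrix valued, and there are $C_{0,V},C_{1,V}>0$ with $C_{0,V}|z'|^2\le\mathcal V_{\mathsf z}(q;z')\le C_{1,V}|z'|^2$ for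 all $q,z'$. $(\mathrm V_u)$: $\mathcal V_{\mathsf u}(q;u')=\frac12\langle\mathbb V_{\mathsf u}(q)u',u'\rangle$ with $\mathbb V_{\mathsf u}\in C^0(\mathcal Q;\mathbb R^{n\times n})$ symmetric-matrix valued, and there are $\widetilde C_{0,V},\widetilde C_{1,V}>0$ with $\widetilde C_{0,V}|u'|^2\le\mathcal V_{\mathsf u}(q;u')\le\widetilde C_{1,V}|u'|^2$ for all $q,u'$. $(\mathrm E)$: $\mathcal E\in C^1([0,T]\times\mathcal Q)$ is bounded from below by a positive constant; there are $C_{0,E},\widetilde C_{0,E},C_{1,E}>0$ with $\mathcal E(t,q)\ge C_{0,E}|q|^2-\widetilde C_{0,E}$ and $|\partial_t\mathcal E(t,q)|\le C_{1,E}\mathcal E(t,q)$ for all $(t,q)\in[0,T]\times\mathcal Q$. $\partial\mathcal R_0(q,z')$ is the convex subdifferential of $\mathcal R_0(q,\cdot)$ at $z'$ (with $0\cdot\partial\mathcal R_0=\{0\}$). $\mathcal V_{\mathsf u}^*(q;\cdot)$ is the convex conjugate of $\mathcal V_{\mathsf u}(q;\cdot)$, and $\mathcal W_{\mathsf z}^*(q;\cdot)$ is the convex conjugate of $\mathcal R_0(q,\cdot)+\mathcal V_{\mathsf z}(q;\cdot)$; it vanishes exactly on $\partial\mathcal R_0(q,0)$. Define $\mathcal M_0:\mathcal Q\times[0,\infty)\times\mathcal Q\times\mathbb R^{n+m}\to[0,\infty]$ by $\mathcal M_0(q,\tau,(u',z'),(\eta,\zeta))=\mathcal R_0(q,z')+\mathcal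 M_0^{\rm red}(q,\tau,(u',z'),(\eta,\zeta))$, where: for $\tau>0$, $\mathcal M_0^{\rm red}=0$ if $\mathcal W_{\mathsf z}^*(q;\zeta)=\mathcal V_{\mathsf u}^*(q;\eta)=0$ and $\mathcal M_0^{\rm red}=\infty$ otherwise; for $\tau=0$ and $\alpha>1$: $\mathcal M_0^{\rm red}=2\sqrt{\mathcal V_{\mathsf u}(q;u')}\sqrt{\mathcal V_{\mathsf u}^*(q;\eta)}$ if $\mathcal V_{\mathsf z}(q;z')=0$; $=2\sqrt{\mathcal V_{\mathsf z}(q;z')}\sqrt{\mathcal W_{\mathsf z}^*(q;\zeta)}$ if $\mathcal V_{\mathsf u}^*(q;\eta)=0$; $=\infty$ if $\mathcal V_{\mathsf z}(q;z')\,\mathcal V_{\mathsf u}^*(q;\eta)>0$; for $\tau=0$ and $\alpha=1$: $\mathcal M_0^{\rm red}=2\sqrt{\mathcal V_{\mathsf z}(q;z')+\mathcal V_{\mathsf u}(q;u')}\sqrt{\mathcal W_{\mathsf z}^*(q;\zeta)+\mathcal V_{\mathsf u}^*(q;\eta)}$; for $\tau=0$ and $\alpha\in(0,1)$: $\mathcal M_0^{\rm red}=2\sqrt{\mathcal V_{\mathsf u}(q;u')}\sqrt{\mathcal V_{\mathsf u}^*(q;\eta)}$ if $\mathcal W_{\mathsf z}^*(q;\zeta)=0$; $=2\sqrt{\mathcal V_{\mathsf z}(q;z')}\sqrt{\mathcal W_{\mathsf z}^*(q;\zeta)}$ if $\mathcal V_{\mathsf u}(q;u')=0$; $=\infty$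 if $\mathcal V_{\mathsf u}(q;u')\,\mathcal W_{\mathsf z}^*(q;\zeta)>0$. Definition. A curve $(\mathsf t,\mathsf q)\in\mathrm{AC}([0,S];[0,T]\times\mathcal Q)$ is a parameterized Balanced Viscosity solution to the rate-independent system $(\mathcal Q,\mathcal E,\mathcal R_0+\varepsilon\mathcal V_{\mathsf z}+\varepsilon^\alpha\mathcal V_{\mathsf u})$ if $\mathsf t$ is nondecreasing and for all $0\le s_1\le s_2\le S$ $$\mathcal E(\mathsf t(s_2),\mathsf q(s_2))+\int_{s_1}^{s_2}\mathcal M_0(\mathsf q(r),\mathsf t'(r),\mathsf q'(r),-\mathrm D_q\mathcal E(\mathsf t(r),\mathsf q(r)))\,dr=\mathcal E(\mathsf t(s_1),\mathsf q(s_1))+\int_{s_1}^{s_2}\partial_t\mathcal E(\mathsf t(r),\mathsf q(r))\,\mathsf t'(r)\,dr.$$ It is non-degenerate if $\mathsf t'(s)+|\mathsf q'(s)|>0$ for a.a. $s\in(0,S)$. (Here $\varepsilon$ is only a formal symbol in the name of the system; the notion depends on $\alpha$.) *)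

(* Defs.v *)
From HB Require Import structures.
From mathcomp Require Import all_boot all_order all_algebra.
From mathcomp Require Import all_classical all_reals all_analysis.
Set Implicit Arguments.
Unset Strict Implicit.
Unset Printing Implicit Defensive.
Import Order.TTheory GRing.Theory Num.Theory.
Import numFieldNormedType.Exports.
Local Open Scope classical_set_scope.
Local Open Scope ring_scope.

(* The product state space: q = (u, z); also used for velocities (u', z') and
   forces (eta, zeta). *)
Notation state R n m := ('cV[R]_n * 'cV[R]_m)%type.

(** Euclidean structure (the library norm on matrices is the sup norm) *)

Definition dot (R : realType) (k : nat) (x y : 'cV[R]_k) : R :=
  \sum_(i < k) x i 0 * y i 0.

Definition enorm (R : realType) (k : nat) (x : 'cV[R]_k) : R :=
  Num.sqrt (dot x x).

Definition enorm_state (R : realType) (n m : nat) (q : state R n m) : R :=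
  Num.sqrt (enorm q.1 ^+ 2 + enorm q.2 ^+ 2).

Definition quad (R : realType) (k : nat) (A : 'M[R]_k) (v : 'cV[R]_k) : R :=
  2^-1 * dot (A *m v) v.

(** Absolutely continuous curves (the library norm is equivalent to the
    Euclidean one, so it gives the same class of curves) *)

Definition abs_cont (R : realType) (V : normedModType R) (a b : R)
    (f : R -> V) : Prop :=
  forall e : R, 0 < e -> exists2 d : R, 0 < d &
    forall (N : nat) (x y : 'I_N -> R),
      (forall i, [/\ a <= x i, x i <= y i & y i <= b]) ->
      trivIset [set: 'I_N] (fun i => `]x i, y i[%classic) ->
      \sum_(i < N) (y i - x i) < d ->
      \sum_(i < N) `|f (y i) - f (x i)| < e.

Definition AC_curve (R : realType) (n m : nat) (T S : R)
    (t : R -> R) (q : R -> state R n m) : Prop :=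
  [/\ abs_cont 0 S (t : R -> R^o), abs_cont 0 S q &
      forall s, 0 <= s <= S -> 0 <= t s <= T].

Definition nondecreasing_on (R : realType) (S : R) (t : R -> R) : Prop :=
  forall s1 s2, 0 <= s1 -> s1 <= s2 -> s2 <= S -> t s1 <= t s2.

(** Convex analysis *)

Definition subdiff (R : realType) (k : nat) (f : 'cV[R]_k -> R)
    (x : 'cV[R]_k) : set 'cV[R]_k :=
  [set w | forall y, f x + dot w (y - x) <= f y].

(* Scaled set c A, with the convention 0 A = {0} whatever A is. *)
Definition scale_set (R : realType) (k : nat) (c : R) (A : set 'cV[R]_k) :
    set 'cV[R]_k :=
  if c == 0 then [set 0] else [set c *: w | w in A].

Definition conjugate_fun (R : realType) (k : nat) (f : 'cV[R]_k -> R)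
    (xi : 'cV[R]_k) : \bar R :=
  ereal_sup [set (dot xi v - f v)%:E | v in [set: 'cV[R]_k]].

(** Derivatives of the energy *)

Definition grad (R : realType) (k : nat) (f : 'cV[R]_k -> R)
    (x : 'cV[R]_k) : 'cV[R]_k :=
  \col_(i < k) 'D_(delta_mx i 0) (f : 'cV[R]_k -> R^o) x.

Definition Du (R : realType) (n m : nat) (E : R -> state R n m -> R)
    (t : R) (q : state R n m) : 'cV[R]_n :=
  grad (fun u => E t (u, q.2)) q.1.

Definition Dz (R : realType) (n m : nat) (E : R -> state R n m -> R)
    (t : R) (q : state R n m) : 'cV[R]_m :=
  grad (fun z => E t (q.1, z)) q.2.

(* Difference quotients in time use times in [0, T] only, hence the time
   derivative is one-sided at t = 0 and t = T. *)
Definition time_quotient (R : realType) (n m : nat)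
    (E : R -> state R n m -> R) (t : R) (q : state R n m) (s : R) : R :=
  (s - t)^-1 * (E s q - E t q).

Definition Dt (R : realType) (n m : nat) (T : R) (E : R -> state R n m -> R)
    (t : R) (q : state R n m) : R :=
  lim (time_quotient E t q @ within `[0, T]%classic t^').

Definition continuous_on_slab (R : realType) (n m : nat) (T : R)
    (V : normedModType R) (F : R -> state R n m -> V) : Prop :=
  {within `[0, T]%classic `*` [set: state R n m],
     continuous (fun p : R * state R n m => F p.1 p.2)}.

Definition C1_energy (R : realType) (n m : nat) (T : R)
    (E : R -> state R n m -> R) : Prop :=
  [/\ forall t q, 0 <= t <= T -> cvg (time_quotient E t q @ within `[0, T]%classic t^'),
      forall t q, 0 <= t <= T -> differentiable (E t : state R n m -> R^o) q,
      continuous_on_slab T (E : R -> state R n m -> R^o),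
      continuous_on_slab T (Dt T E : R -> state R n m -> R^o) &
      continuous_on_slab T (Du E) /\ continuous_on_slab T (Dz E)].

(** Standing assumptions *)

Definition assumption_R0 (R : realType) (n m : nat)
    (R0 : state R n m -> 'cV[R]_m -> R) : Prop :=
  [/\ continuous (fun p : state R n m * 'cV[R]_m => R0 p.1 p.2 : R^o),
      forall q, convex_function [set: 'cV[R]_m] (R0 q),
      forall q (c : R) z', 0 < c -> R0 q (c *: z') = c * R0 q z' &
      exists C0 C1 : R, [/\ 0 < C0, 0 < C1 &
        forall q z', C0 * enorm z' <= R0 q z' <= C1 * enorm z']].

(* Both (V_z) (with k = m) and (V_u) (with k = n). *)
Definition assumption_V (R : realType) (n m k : nat)
    (A : state R n m -> 'M[R]_k) : Prop :=
  [/\ continuous A,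
      forall q, (A q)^T = A q &
      exists C0 C1 : R, [/\ 0 < C0, 0 < C1 &
        forall q v, C0 * enorm v ^+ 2 <= quad (A q) v <= C1 * enorm v ^+ 2]].

Definition assumption_E (R : realType) (n m : nat) (T : R)
    (E : R -> state R n m -> R) : Prop :=
  [/\ C1_energy T E,
      exists2 c : R, 0 < c & forall t q, 0 <= t <= T -> c <= E t q,
      exists C0 C0' : R, [/\ 0 < C0, 0 < C0' &
        forall t q, 0 <= t <= T -> C0 * enorm_state q ^+ 2 - C0' <= E t q] &
      exists2 C1 : R, 0 < C1 &
        forall t q, 0 <= t <= T -> `|Dt T E t q| <= C1 * E t q].

(** The vanishing-viscosity contact potential *)

Definition Vu_conj (R : realType) (n m : nat) (Vu : state R n m -> 'M[R]_n)
    (q : state R n m) : 'cV[R]_n -> \bar R :=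
  conjugate_fun (quad (Vu q)).

Definition Wz_conj (R : realType) (n m : nat)
    (R0 : state R n m -> 'cV[R]_m -> R) (Vz : state R n m -> 'M[R]_m)
    (q : state R n m) : 'cV[R]_m -> \bar R :=
  conjugate_fun (fun z' => R0 q z' + quad (Vz q) z').

(* Only tau >= 0 is meaningful, so the last branch is tau = 0. *)
Definition M0_red (R : realType) (n m : nat) (alpha : R)
    (R0 : state R n m -> 'cV[R]_m -> R) (Vz : state R n m -> 'M[R]_m)
    (Vu : state R n m -> 'M[R]_n) (q : state R n m) (tau : R)
    (q' : state R n m) (xi : state R n m) : \bar R :=
  let vu := (quad (Vu q) q'.1)%:E in
  let vz := (quad (Vz q) q'.2)%:E in
  let vus := Vu_conj Vu q xi.1 in
  let wzs := Wz_conj R0 Vz q xi.2 in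
  (if (0 < tau)%R then
     if (wzs == 0) && (vus == 0) then 0 else +oo
   else if (1 < alpha)%R then
     if vz == 0 then 2%:E * sqrte vu * sqrte vus
     else if vus == 0 then 2%:E * sqrte vz * sqrte wzs
     else +oo
   else if alpha == 1%R then
     2%:E * sqrte (vz + vu) * sqrte (wzs + vus)
   else
     if wzs == 0 then 2%:E * sqrte vu * sqrte vus
     else if vu == 0 then 2%:E * sqrte vz * sqrte wzs
     else +oo)%E.

Definition M0 (R : realType) (n m : nat) (alpha : R)
    (R0 : state R n m -> 'cV[R]_m -> R) (Vz : state R n m -> 'M[R]_m)
    (Vu : state R n m -> 'M[R]_n) (q : state R n m) (tau : R)
    (q' : state R n m) (xi : state R n m) : \bar R :=
  ((R0 q q'.2)%:E + M0_red alpha R0 Vz Vu q tau q' xi)%E.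

(** Balanced Viscosity solutions.  Derivatives of the curves are two-sided
    limits, which exist almost everywhere in (0, S) by absolute continuity. *)

Definition BV_solution (R : realType) (n m : nat) (alpha T S : R)
    (R0 : state R n m -> 'cV[R]_m -> R) (Vz : state R n m -> 'M[R]_m)
    (Vu : state R n m -> 'M[R]_n) (E : R -> state R n m -> R)
    (t : R -> R) (q : R -> state R n m) : Prop :=
  [/\ AC_curve T S t q, nondecreasing_on S t &
      forall s1 s2 : R, 0 <= s1 -> s1 <= s2 -> s2 <= S ->
      ((E (t s2) (q s2))%:E
         + \int[@lebesgue_measure R]_(r in `[s1, s2])
             M0 alpha R0 Vz Vu (q r) (derive1 t r) (derive1 q r)
                (- Du E (t r) (q r), - Dz E (t r) (q r))%R
       = (E (t s1) (q s1))%:E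
         + \int[@lebesgue_measure R]_(r in `[s1, s2])
             (Dt T E (t r) (q r) * derive1 t r)%:E)%E].

Definition non_degenerate (R : realType) (n m : nat) (S : R)
    (t : R -> R) (q : R -> state R n m) : Prop :=
  {ae @lebesgue_measure R, forall s : R, 0 < s < S ->
     0 < derive1 t s + enorm_state (derive1 q s)}.

(* Main.v *)
Require Import Defs.
From HB Require Import structures.
From mathcomp Require Import all_boot all_order all_algebra.
From mathcomp Require Import all_classical all_reals all_analysis.
From mathcomp Require Import measurable_realfun ring lra.
Set Implicit Arguments.
Unset Strict Implicit.
Unset Printing Implicit Defensive.
Import Order.TTheory GRing.Theory Num.Theory.
Import numFieldNormedType.Exports.
Local Open Scope classical_set_scope.
Local Open Scope ring_scope.

(** The energy balance says that the power lost by the energy along the curve is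
    exactly the contact potential [M0]. The proof compares the two integrands.

    The chain rule gives
      [d/ds E(t, q) = Dt E t' + <Du E, u'> + <Dz E, z'>]
    almost everywhere, and integrating it turns the balance into
      [int M0 = int <- D E, q'>]  over every subinterval of [[0, S]].
    Pointwise, [M0 >= <- D E, q'>] always holds. Hence the balance on [[0, S]]
    alone forces [M0 = <- D E, q'>] almost everywhere, and this equality in turn
    yields the balance on every subinterval. What remains is to read equality of
    [M0] and the power, at one point, as the system with the parameters [theta].

    Pointwise part. Put [a = V_u(u')], [b = V_z(z')], [p = V_u^*(eta)] and
    [r = W_z^*(zeta)]. Scaling the velocity in the Fenchel inequality gives
      [<eta, u'> <= 2 sqrt a sqrt p],
      [<zeta, z'> - R_0(z') <= 2 sqrt b sqrt r],
    and the reduced potential is at least [2 sqrt a sqrt p + 2 sqrt b sqrt r].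
    So equality means equality in all three. Equality for one variable, together
    with [(1 - theta) sqrt p = theta sqrt a], is the flow rule with parameter
    [theta] ([flow_ruleP]): the multiple of the velocity at which the conjugate
    is attained satisfies a first-order condition. Equality in the third
    inequality is the switching condition that depends on [alpha]
    ([red_potential_balance], [balance_switch]), with an explicit choice of
    [theta_u], [theta_z] in terms of [a], [b], [p], [r]; this makes them Borel.

    Analytic part. An absolutely continuous real function is almost everywhere
    differentiable and is the integral of its derivative ([ac_FTC]): it is a
    difference of two nondecreasing absolutely continuous functions, whose
    Lebesgue-Stieltjes measures have a Radon-Nikodym density. The energy along
    the curve is absolutely continuous because the segments joining points of
    the curve fill a compact set, on which the derivatives of [E] are bounded.
    Measurability of everything that involves derivatives of the curve comes
    from writing them as limits of difference quotients. *)

(** * Clamping and families of disjoint intervals *)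

Section clamp.
Context {R : realType}.
Implicit Types a b c x y : R.

(** Composing with [clamp a b] extends a curve from [[a, b]] to the whole line
    by constants, keeping continuity and monotonicity; composing the end points
    of intervals with it cuts these intervals. *)
Definition clamp a b x := Num.max a (Num.min x b).

Lemma clamp_ge a b x : a <= clamp a b x.
Proof. by rewrite le_max lexx. Qed.

Lemma clamp_le a b x : a <= b -> clamp a b x <= b.
Proof. by move=> ab; rewrite ge_max ab ge_min lexx orbT. Qed.

Lemma clamp_homo a b x y : x <= y -> clamp a b x <= clamp a b y.
Proof.
move=> xy; rewrite ge_max le_max lexx/= le_max.
by rewrite !le_min !ge_min xy lexx !orbT.
Qed.

Lemma clamp_id a b x : a <= x <= b -> clamp a b x = x.
Proof. by move=> /andP[ax xb]; rewrite /clamp (min_idPl xb) (max_idPr ax). Qed.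

Lemma clamp_itv_sub a b x y z : a <= b ->
  clamp a b x < z < clamp a b y -> x < z < y.
Proof.
move=> ab /andP[xz zy]; have zid : clamp a b z = z.
  by apply: clamp_id; rewrite (le_trans (clamp_ge a b x) (ltW xz)) (le_trans (ltW zy)) ?clamp_le.
rewrite !ltNge; apply/andP; split; apply/negP => /(clamp_homo a b); rewrite zid.
  by rewrite leNgt xz.
by rewrite leNgt zy.
Qed.

Lemma clamp_lip a b x y : a <= b -> x <= y ->
  clamp a b y - clamp a b x <= y - x.
Proof.
move=> ab xy; rewrite lerBlDr {1}/clamp ge_max.
rewrite ler_wpDl ?clamp_ge ?subr_ge0//=.
have [xb|/ltW bx] := leP x b.
  rewrite ge_min -lerBlDl opprB addrC subrK {1}/clamp.
  by rewrite (min_idPl xb) le_max lexx orbT.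
by rewrite ge_min orbC ler_wpDl ?subr_ge0// /clamp (min_idPr bx) le_max lexx orbT.
Qed.

(** One of the two clamps is [x], the other one is [c]. *)
Lemma clamp_cut (f : R -> R) a b c x : a <= c <= b -> a <= x <= b ->
  f x + f c = f (clamp a c x) + f (clamp c b x).
Proof.
move=> /andP[ac cb] /andP[ax xb]; case: (leP x c) => xc.
  rewrite (@clamp_id a c x) ?ax// /clamp.
  by rewrite (min_idPl xb) (max_idPl xc).
rewrite (@clamp_id c b x) ?xb ?(ltW xc)// /clamp.
by rewrite (min_idPr (ltW xc)) (max_idPr ac) addrC.
Qed.

Lemma clamp_continuous a b : continuous (clamp a b).
Proof.
move=> x; apply: (@continuous_max _ _ (cst a) (fun y => Num.min y b)).
  exact: cst_continuous.
apply: (@continuous_min _ _ id (cst b)); [exact: cvg_id|exact: cst_continuous].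
Qed.

End clamp.

Lemma trivIset_subset (I T : Type) (D : set I) (A B : I -> set T) :
  (forall i, A i `<=` B i) -> trivIset D B -> trivIset D A.
Proof.
by move=> AB tB i j Di Dj [z [/AB zi /AB zj]]; apply: tB => //; exists z.
Qed.

Section interval_family.
Context {R : realType}.
Implicit Types (a b c : R) (f : R -> R).
Local Notation mu := (@lebesgue_measure R).

Definition interval_family a b (I : finType) (x y : I -> R) : Prop :=
  (forall i, [/\ a <= x i, x i <= y i & y i <= b]) /\
  trivIset [set: I] (fun i => `]x i, y i[%classic).

(** Absolute continuity is tested here on families indexed by an arbitrary
    finite type rather than by some ['I_N]: such families can be merged along a
    sigma type and extended along an option type. *)
Definition ac_family a b f : Prop :=
  forall e, 0 < e -> exists2 d, 0 < d &
    forall (I : finType) (x y : I -> R), interval_family a b x y ->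
    \sum_i (y i - x i) < d -> \sum_i `|f (y i) - f (x i)| < e.

Lemma fsum_finType (I : finType) (F : I -> \bar R) :
  (\sum_(i \in [set: I]) F i = \sum_(i : I) F i)%E.
Proof.
rewrite (_ : [set: I] = [set` index_enum I]); last first.
  by apply/seteqP; split=> // i _ /=; rewrite mem_index_enum.
by rewrite -fsbig_seq// index_enum_uniq.
Qed.

Lemma sum_length_le (U : set R) (I : finType) (x y : I -> R) :
  measurable U -> (forall i, x i <= y i) ->
  trivIset [set: I] (fun i => `]x i, y i[%classic) ->
  (forall i, `]x i, y i[%classic `<=` U) ->
  ((\sum_i (y i - x i))%:E <= mu U)%E.
Proof.
move=> mU xy tI sU.
have fT : finite_set [set: I] by exact: finite_finset.
have -> : ((\sum_i (y i - x i))%:E =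
    mu (\bigcup_(i in [set: I]) `]x i, y i[%classic))%E.
  rewrite measure_fin_bigcup// fsum_finType -sumEFin; apply: eq_bigr => i _.
  rewrite /= lebesgue_measure_itv/= lte_fin; case: ltP => // yx.
  by rewrite (@le_anti _ _ (x i) (y i)) ?xy// subrr.
apply: le_measure; rewrite ?inE//.
- by apply: fin_bigcup_measurable.
- by apply: bigcup_sub => i _.
Qed.

Lemma interval_family_length a b (I : finType) (x y : I -> R) :
  a <= b -> interval_family a b x y -> \sum_i (y i - x i) <= b - a.
Proof.
move=> ab [h tI]; rewrite -lee_fin.
have -> : (b - a)%:E = mu `[a, b].
  rewrite lebesgue_measure_itv/= lte_fin; case: ltP => // ba.
  by rewrite (@le_anti _ _ a b) ?ab// subrr.
apply: sum_length_le => //; first by move=> i; case: (h i).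
move=> i z /=; rewrite !in_itv/=; case: (h i) => ai _ bi /andP[xz zy].
by rewrite (le_trans ai (ltW xz)) (le_trans (ltW zy) bi).
Qed.

Lemma abs_cont_family a b f : abs_cont a b (f : R -> R^o) -> ac_family a b f.
Proof.
move=> acf e e0; have [d d0 H] := acf e e0; exists d => // I x y [xy tI].
have bij : {on [pred i : I | true], bijective (@enum_val I xpredT)}.
  exact/onW_bij/enum_val_bij.
rewrite (reindex _ bij) [in X in _ -> X](reindex _ bij) /= => sd.
apply: (H _ (fun k => x (enum_val k)) (fun k => y (enum_val k)) _ _ sd).
  by move=> k; exact: xy.
move=> i j _ _ /tI h; apply: (@enum_val_inj I xpredT); exact: h.
Qed.

Lemma interval_family_clamp a b (I : finType) (x y : I -> R) :
  a <= b -> (forall i, x i <= y i) ->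
  trivIset [set: I] (fun i => `]x i, y i[%classic) ->
  interval_family a b (clamp a b \o x) (clamp a b \o y).
Proof.
move=> ab xy tI; split=> [i|].
  by split; [exact: clamp_ge|exact: clamp_homo|exact: clamp_le].
apply: trivIset_subset tI => i z /=; rewrite !in_itv/=.
exact: clamp_itv_sub.
Qed.

Lemma interval_family_cut f a b c (I : finType) (x y : I -> R) :
  a <= c <= b -> interval_family a b x y ->
  \sum_i (f (y i) - f (x i)) =
  \sum_i (f (clamp a c (y i)) - f (clamp a c (x i))) +
  \sum_i (f (clamp c b (y i)) - f (clamp c b (x i))).
Proof.
move=> acb [h _]; rewrite -big_split/=; apply: eq_bigr => i _.
case: (h i) => ax xy yb.
have := @clamp_cut _ f a b c (x i) acb; have := @clamp_cut _ f a b c (y i) acb.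
rewrite ax yb (le_trans ax xy) (le_trans xy yb) => /(_ isT) Y /(_ isT) X.
lra.
Qed.

End interval_family.

(** * Jordan decomposition of absolutely continuous functions *)

Section positive_variation.
Context {R : realType}.
Variables (a b : R) (f : R -> R).
Hypotheses (ab : a <= b) (acf : abs_cont a b (f : R -> R^o)).

Definition variation_sums c d : set R :=
  [set r | exists (I : finType) (x y : I -> R),
    interval_family c d x y /\ r = \sum_i (f (y i) - f (x i))].

(** Positive increments only: if [P] is this variation, then [P] and [P - f] are
    both nondecreasing, which is all that a Jordan decomposition requires. *)
Definition pos_variation d : R := sup (variation_sums a d).

Lemma variation_sums_neq0 c d : variation_sums c d !=set0.
Proof.
exists 0, void, (fun=> 0), (fun=> 0); split; last by rewrite big1 => [|[]].
by split=> [[]|[]].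
Qed.

(** Absolute continuity with [e = 1] provides a length below which every family
    has variation at most [1]; the interval is cut into finitely many slices of
    half that length, which are removed one after the other. *)
Lemma variation_sums_bounded : exists K, forall d, a <= d <= b ->
  ubound (variation_sums a d) K.
Proof.
have [d d0 H] := abs_cont_family acf ltr01.
pose h := d / 2; have h0 : 0 < h by rewrite divr_gt0.
have claim k c : a <= c <= b -> c <= a + k%:R * h ->
    ubound (variation_sums a c) k%:R.
  elim: k c => [|k IH] c /andP[ac cb] ck _ [I [x [y [F ->]]]].
    rewrite big1// => i _; case: F => /(_ i)[ax xy yc] _.
    move: ck; rewrite mul0r addr0 => ca.
    by rewrite (_ : x i = y i) ?subrr//; lra.
  pose c' := Num.max a (c - h).
  have acc' : a <= c' <= c.
    by rewrite le_max lexx/= ge_max ac lerBlDr lerDl ltW.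
  have /andP[ac' c'c] := acc'.
  rewrite (interval_family_cut f acc' F) -natr1; apply: lerD.
    apply: (IH c'); first by rewrite ac' (le_trans c'c).
      rewrite ge_max lerDl mulr_ge0 ?(ltW h0)//=.
      by move: ck; rewrite -natr1 mulrDl mul1r; lra.
    exists I, (clamp a c' \o x), (clamp a c' \o y); split => //.
    by case: F => F1 F2; apply: interval_family_clamp => // i; case: (F1 i).
  have F' : interval_family c' c (clamp c' c \o x) (clamp c' c \o y).
    by case: F => F1 F2; apply: interval_family_clamp => // i; case: (F1 i).
  apply: (@le_trans _ _ (\sum_i `|f (clamp c' c (y i)) - f (clamp c' c (x i))|)).
    by apply: ler_sum => i _; exact: ler_norm.
  apply/ltW/(H I (clamp c' c \o x) (clamp c' c \o y)).
    case: F' => F1 F2; split=> // i; case: (F1 i) => p q r; split=> //.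
      exact: le_trans p.
    exact: le_trans cb.
  apply: le_lt_trans (interval_family_length c'c F') _.
  rewrite /c'; apply: (@le_lt_trans _ _ h); last by rewrite /h; lra.
  by rewrite lerBlDr -lerBlDl le_max lexx orbT.
have [k hk] : exists k : nat, (b - a) / h <= k%:R.
  exists (Num.bound ((b - a) / h)); apply: ltW.
  by rewrite archi_boundP// divr_ge0 ?subr_ge0// ltW.
exists k%:R => c /andP[ac cb]; apply: claim; first by rewrite ac.
by move: hk; rewrite ler_pdivrMr//; lra.
Qed.

Lemma has_sup_variation d : a <= d <= b -> has_sup (variation_sums a d).
Proof.
move=> adb; split; first exact: variation_sums_neq0.
by have [K HK] := variation_sums_bounded; exists K; exact: HK.
Qed.

(** A family in [[a, x]] may be completed by the interval from [x] to [y] when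
    the increment of [f] over it is positive. *)
Lemma pos_variation_ge x y : a <= x -> x <= y -> y <= b ->
  pos_variation x + Num.max 0 (f y - f x) <= pos_variation y.
Proof.
move=> ax xy yb; rewrite -lerBrDr.
apply: ge_sup; first exact: variation_sums_neq0.
move=> _ [I [u [v [[F tF] ->]]]]; rewrite lerBrDr.
have ayb : a <= y <= b by rewrite yb (le_trans ax xy).
have [_ hub] := has_sup_variation ayb.
have [fxy|fxy] := leP 0 (f y - f x); last first.
  rewrite addr0; apply: ub_le_sup => //; exists I, u, v; split => //.
  by split => // i; case: (F i) => p q r; split => //; exact: le_trans xy.
apply: ub_le_sup => //.
pose u' (i : option I) := if i is Some j then u j else x.
pose v' (i : option I) := if i is Some j then v j else y.
exists (option I), u', v'; split.
  split=> [[i|]/=|].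
  - by case: (F i) => p q r; split => //; exact: le_trans xy.
  - by split.
  move=> [i|] [j|] _ _ //= [z [/=]]; rewrite !in_itv/= => zi zj.
  - by congr Some; apply: tF => //; exists z; split => /=; rewrite in_itv.
  - by exfalso; case: (F i) => *; lra.
  - by exfalso; case: (F j) => *; lra.
rewrite (bigD1 None)//= addrC; congr (_ + _).
rewrite (reindex_omap Some id)/=; last by case.
by apply: eq_big => // i; rewrite eqxx.
Qed.

End positive_variation.

Lemma ac_familyB (R : realType) (a b : R) (f g : R -> R) :
  ac_family a b f -> ac_family a b g -> ac_family a b (fun x => f x - g x).
Proof.
move=> acf acg e e0; have e2 : 0 < e / 2 by rewrite divr_gt0.
have [d1 d10 H1] := acf _ e2; have [d2 d20 H2] := acg _ e2.
exists (Num.min d1 d2); first by rewrite lt_min d10.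
move=> I x y F; rewrite lt_min => /andP[/(H1 _ _ _ F) h1 /(H2 _ _ _ F) h2].
rewrite [e]splitr; apply: le_lt_trans (ltrD h1 h2).
rewrite -big_split/=; apply: ler_sum => i _.
rewrite (_ : _ - _ = (f (y i) - f (x i)) - (g (y i) - g (x i))); last lra.
exact: ler_normB.
Qed.

(** Almost optimal families inside each interval of a given family merge into a
    single family which is not longer, so that the absolute continuity of [f]
    applies to it. *)
Lemma pos_variation_ac (R : realType) (a b : R) (f : R -> R) :
  a <= b -> abs_cont a b (f : R -> R^o) -> ac_family a b (pos_variation a f).
Proof.
move=> ab acf e e0; have e2 : 0 < e / 2 by rewrite divr_gt0.
have [d d0 H] := abs_cont_family acf e2; exists d => // I X Y [XY tXY] XYd.
set P := pos_variation a f.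
(* one error [e'] for each interval: altogether at most [e / 2] *)
pose e' := e / 2 / #|I|.+1%:R.
have e'0 : 0 < e' by rewrite divr_gt0.
have /choice[F HF] : forall i, exists F : {J : finType & ((J -> R) * (J -> R))%type},
    interval_family (X i) (Y i) (projT2 F).1 (projT2 F).2 /\
    P (Y i) - P (X i) - e' <
      \sum_j (f ((projT2 F).2 j) - f ((projT2 F).1 j)).
  move=> i; have [aX XYi Yb] := XY i.
  have aYb : a <= Y i <= b by rewrite Yb (le_trans aX).
  have aXb : a <= X i <= b by rewrite aX (le_trans XYi).
  have [_ [J [u [v [Fam ->]]]] ltP] :=
    sup_adherent e'0 (has_sup_variation ab acf aYb).
  have aXY : a <= X i <= Y i by rewrite aX.
  exists (existT _ J (clamp (X i) (Y i) \o u, clamp (X i) (Y i) \o v)).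
  split=> /=.
    by case: Fam => F1 F2; apply: interval_family_clamp => // j; case: (F1 j).
  move: ltP; rewrite (interval_family_cut f aXY Fam) -/(pos_variation a f (Y i)) -/P.
  suff : \sum_j (f (clamp a (X i) (v j)) - f (clamp a (X i) (u j))) <= P (X i).
    lra.
  have [_ hub] := has_sup_variation ab acf aXb.
  apply: ub_le_sup => //; exists J, (clamp a (X i) \o u), (clamp a (X i) \o v).
  by split=> //; case: Fam => F1 F2; apply: interval_family_clamp => // j; case: (F1 j).
have PXY i : P (X i) <= P (Y i).
  have [aX XYi Yb] := XY i.
  have := pos_variation_ge ab acf aX XYi Yb; rewrite -/P.
  by apply: le_trans; rewrite lerDl le_max lexx.
pose J := {i : I & projT1 (F i)}.
pose u (p : J) := (projT2 (F (tag p))).1 (tagged p).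
pose v (p : J) := (projT2 (F (tag p))).2 (tagged p).
have Fuv : interval_family a b u v.
  split=> [[i j]|].
    rewrite /u /v /=; have [[h _] _] := HF i; case: (h j) => p q r.
    by case: (XY i) => aX _ Yb; split=> //; [exact: le_trans p|exact: le_trans Yb].
  move=> [i j] [i' j'] _ _ [z []]; rewrite /u /v /= !in_itv/= => zi zj.
  have Ei : i = i'.
    apply: tXY => //; exists z; rewrite /= !in_itv/=.
    have [[/(_ j)[p _ r] _] _] := HF i; have [[/(_ j')[p' _ r'] _] _] := HF i'.
    by split; lra.
  subst i'; congr existT; have [[_ t] _] := HF i.
  by apply: t => //; exists z; rewrite /= !in_itv.
have sumJ (G : forall i, projT1 (F i) -> R) :
    \sum_(p : J) G (tag p) (tagged p) = \sum_i \sum_j G i j.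
  by rewrite sig_big_dep.
have luv : \sum_p (v p - u p) < d.
  rewrite (sumJ (fun i j => (projT2 (F i)).2 j - (projT2 (F i)).1 j)).
  apply: le_lt_trans XYd; apply: ler_sum => i _.
  by apply: interval_family_length; [case: (XY i)|case: (HF i)].
have := H _ _ _ Fuv luv.
have le1 : \sum_i (P (Y i) - P (X i) - e') <= \sum_p `|f (v p) - f (u p)|.
  rewrite (sumJ (fun i j => `|f ((projT2 (F i)).2 j) - f ((projT2 (F i)).1 j)|)).
  apply: ler_sum => i _; apply: le_trans (ltW (HF i).2) _.
  by apply: ler_sum => j _; exact: ler_norm.
move=> /(le_lt_trans le1); rewrite big_split/= sumr_const => ltS.
rewrite (eq_bigr (fun i => P (Y i) - P (X i))); last first.
  by move=> i _; rewrite ger0_norm// subr_ge0.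
suff : e' *+ #|I| <= e / 2 by move: ltS; rewrite mulNrn; lra.
rewrite /e' -mulr_natr mulrAC -mulrA ler_piMr ?(ltW e2)//.
by rewrite ler_pdivrMr// mul1r ler_nat.
Qed.

(** * Densities and the fundamental theorem of calculus *)

Section nondecreasing_density.
Context {R : realType}.
Variables (a b : R) (g : R -> R).
Hypotheses (ab : a <= b) (acg : ac_family a b g).
Hypothesis ndg : forall x y, a <= x -> x <= y -> y <= b -> g x <= g y.
Local Notation mu := (@lebesgue_measure R).

Let G := g \o clamp a b.

Let ndG : nondecreasing G.
Proof.
move=> x y xy; apply: ndg; [exact: clamp_ge|exact: clamp_homo|exact: clamp_le].
Qed.

Let acG e : 0 < e -> exists2 d, 0 < d &
  forall (I : finType) (x y : I -> R), (forall i, x i <= y i) ->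
  trivIset [set: I] (fun i => `]x i, y i[%classic) ->
  \sum_i (y i - x i) < d -> \sum_i (G (y i) - G (x i)) < e.
Proof.
move=> e0; have [d d0 H] := acg e0; exists d => // I x y xy tI xyd.
have Fam := interval_family_clamp ab xy tI.
apply: le_lt_trans (H _ _ _ Fam _).
  by apply: ler_sum => i _; exact: ler_norm.
by apply: le_lt_trans xyd; apply: ler_sum => i _; exact: clamp_lip.
Qed.

Let rcG : right_continuous G.
Proof.
apply: right_continuousW => x; apply/cvgrPdist_lt => e e0.
have [d d0 H] := acG e0; near=> y.
have {}H u v : u <= v -> v - u < d -> G v - G u < e.
  move=> uv vud.
  have := H unit (fun=> u) (fun=> v); rewrite !big_const cardT enumT.
  rewrite !unlock/= !addr0; apply => //; by move=> [] [].
have : `|x - y| < d by near: y; apply: cvgr_dist_lt => //; exact: cvg_id.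
have [xy|/ltW yx] := leP x y.
  rewrite distrC ger0_norm ?subr_ge0// distrC ger0_norm ?subr_ge0//; last exact: ndG.
  exact: H.
rewrite ger0_norm ?subr_ge0// ger0_norm ?subr_ge0//; last exact: ndG.
exact: H.
Unshelve. all: by end_near. Qed.

Let Gc : cumulative R R := HB.pack G (isCumulative.Build R _ R G ndG rcG).

Let nu := lebesgue_stieltjes_measure Gc.

Let nu_itv x y : x <= y -> nu `]x, y]%classic = (G y - G x)%:E.
Proof.
move=> xy; rewrite /= /nu/= /lebesgue_stieltjes_measure.
rewrite /measure_extension measurable_mu_extE/=; last exact: is_ocitv.
by rewrite wlength_itv_bnd.
Qed.

(** The sets [inner_part U n] increase to the open set [U]. As their points stay
    away from the complement of [U], they are covered by finitely many disjoint
    cells contained in [U]. *)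
Let inner_part (U : set R) (n : nat) : set R :=
  `[- n%:R, n%:R]%classic `&`
  \bigcap_(z in ~` U) [set x | n.+1%:R^-1 <= `|x - z|].

Let inner_part_measurable U n : measurable (inner_part U n).
Proof.
apply: measurableI => //; apply: closed_measurable; apply: closed_bigI => z _.
apply: (@preimage_closed _ _ (fun x : R => `|x - z|) [set r | n.+1%:R^-1 <= r]).
  move=> x _; apply: cvg_norm; apply: cvgB; [exact: cvg_id|exact: cvg_cst].
exact: closed_ge.
Qed.

Let bigcup_inner_part U : open U -> \bigcup_n inner_part U n = U.
Proof.
move=> oU; apply/seteqP; split=> [x [n _ [_ h]]|x Ux].
  apply: contrapT => nUx; have := h x nUx.
  by rewrite /= subrr normr0 leNgt invr_gt0 ltr0Sn.
have [e e0 xe] : exists2 e, 0 < e & forall y, `|x - y| < e -> U y.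
  by have /nbhs_ballP[e e0 h] := open_nbhs_nbhs (conj oU Ux); exists e.
exists (Num.bound `|x| + Num.bound e^-1)%N => //; split => /=.
  rewrite in_itv/= -ler_norml natrD; apply: ler_wpDr => //.
  by rewrite ltW// archi_boundP.
move=> z nUz; rewrite /= leNgt; apply/negP => xz; apply: nUz; apply: xe.
apply: lt_le_trans xz _.
rewrite -[leRHS]invrK lef_pV2 ?posrE ?invr_gt0//.
rewrite -addnS natrD addrC; apply: ler_wpDr => //.
rewrite (le_trans (ltW (@archi_boundP _ e^-1 _)))// ?invr_ge0 ?(ltW e0)//.
by rewrite ler_nat.
Qed.

Let inner_part_homo U : {homo inner_part U : n m / (n <= m)%N >-> (n <= m)%O}.
Proof.
move=> n m nm; apply/subsetPset => x [/= xn h]; split.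
  have : n%:R <= m%:R :> R by rewrite ler_nat.
  by rewrite /= !in_itv/= in xn *; lra.
move=> z nUz; apply: le_trans (h z nUz).
by rewrite lef_pV2 ?posrE// ler_nat ltnS.
Qed.

(** The cells of length [w] that lie in [U] form a family of total length at
    most [mu U < d], hence of [G]-variation less than [e]; as [w < n.+1^-1],
    every cell that meets [inner_part U n] is one of them. *)
Let nu_inner_part U e d : measurable U -> 
  (forall (I : finType) (x y : I -> R), (forall i, x i <= y i) ->
  trivIset [set: I] (fun i => `]x i, y i[%classic) ->
  \sum_i (y i - x i) < d -> \sum_i (G (y i) - G (x i)) < e) ->
  (mu U < d%:E)%E -> forall n, (nu (inner_part U n) <= e%:E)%E.
Proof.
move=> mU H Ud n.
pose w : R := n.+2%:R^-1; pose c : R := - n.+1%:R.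
have w0 : 0 < w by rewrite invr_gt0.
pose M := (n.+2 * (n + n.+1).+1)%N.
pose cell k := `]c + k%:R * w, c + k.+1%:R * w]%classic : set R.
pose x (k : 'I_M) : R := c + k%:R * w.
(* the cells that leave [U] are kept as degenerate intervals *)
pose y (k : 'I_M) : R := if `[< cell k `<=` U >] then c + k.+1%:R * w else x k.
have xy k : x k <= y k.
  rewrite /y; case: asboolP => _ //.
  by rewrite lerD2l ler_wpM2r ?(ltW w0)// ler_nat.
have sub_cell k z : x k < z <= y k -> cell k z.
  rewrite /y /cell /x /= in_itv/=; case: asboolP => _ //.
  by move=> /andP[p q]; move: (lt_le_trans p q); rewrite ltxx.
have sub_cellU k z : x k < z <= y k -> U z.
  move=> xzy; have := sub_cell _ _ xzy.
  move: xzy; rewrite /y; case: asboolP => // [cU _|_ /andP[p q]]; first exact: cU.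
  by move: (lt_le_trans p q); rewrite ltxx.
have tI : trivIset [set: 'I_M] (fun i => `]x i, y i[%classic).
  move=> i j _ _ [z []]; rewrite /= !in_itv/= => /andP[zi zi'] /andP[zj zj'].
  have := sub_cell i z; have := sub_cell j z.
  rewrite zi zj !ltW// => /(_ isT) + /(_ isT).
  rewrite /cell/= !in_itv/= => /andP[p q] /andP[p' q'].
  have lt_cell (u v : nat) : c + u%:R * w < c + v%:R * w -> (u < v)%N.
    by rewrite ltrD2l ltr_pM2r// ltr_nat.
  apply/val_inj/eqP; rewrite eqn_leq/= -ltnS (lt_cell i j.+1); last first.
    exact: lt_le_trans q.
  by rewrite -ltnS (lt_cell j i.+1)//; exact: lt_le_trans q'.
have sumd : \sum_i (y i - x i) < d.
  rewrite -lte_fin; apply: le_lt_trans Ud; apply: sum_length_le => //.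
  move=> i z /=; rewrite in_itv/= => /andP[p q].
  by apply: (sub_cellU i); rewrite p ltW.
have := H _ _ _ xy tI sumd; rewrite -lte_fin => /ltW; apply: le_trans.
have -> : ((\sum_i (G (y i) - G (x i)))%:E =
    \sum_(i \in [set: 'I_M]) nu `]x i, y i]%classic)%E.
  by rewrite fsum_finType -sumEFin; apply: eq_bigr => i _; rewrite nu_itv.
apply: content_sub_fsum => //.
  exact: finite_finset.
  exact: inner_part_measurable.
move=> z [/=]; rewrite in_itv/= => zn hz.
have Mge : (n%:R + n.+1%:R) * n.+2%:R <= M%:R :> R.
  by rewrite -natrD -natrM ler_nat /M mulnC leq_mul2l leqnSn orbT.
have zc : z - c <= n%:R + n.+1%:R by rewrite /c opprK lerD2r; case/andP: zn.
have ex : exists k : nat, z - c <= k.+1%:R * w.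
  exists M; rewrite -ler_pdivrMr// invrK.
  apply: le_trans (_ : M%:R <= _); last by rewrite ler_nat.
  by apply: le_trans Mge; rewrite ler_wpM2r.
have [k kmin] := ex_minnP ex.
move=> kle; have kz : k%:R * w < z - c.
  case: k kmin kle => [|k] kmin kle.
    by rewrite mul0r subr_gt0 /c -natr1; move: zn; lra.
  by rewrite ltNge; apply/negP => /kle; rewrite ltnn.
have kM : (k < M)%N.
  rewrite -(ltr_nat R) -(ltr_pM2r w0); apply: lt_le_trans kz _.
  apply: le_trans zc _; rewrite -ler_pdivrMr// invrK; exact: Mge.
exists (Ordinal kM) => //=; rewrite in_itv/= /y /x/=.
have -> : `[< cell k `<=` U >].
  apply/asboolP => s; rewrite /cell/= in_itv/= => /andP[s1 s2].
  apply: contrapT => nUs; have := hz s nUs; rewrite /= leNgt => /negP; apply.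
  apply: (@le_lt_trans _ _ w); last first.
    by rewrite /w ltf_pV2 ?posrE// ltr_nat.
  rewrite ler_norml; move: s1 s2 kmin kz; rewrite -natr1 mulrDl mul1r; lra.
by move: kmin kz; lra.
Qed.

(** Outer regularity encloses [N] in an open set of arbitrarily small Lebesgue
    measure. *)
Let nu_null N : measurable N -> mu N = 0%E -> nu N = 0%E.
Proof.
move=> mN N0; apply/eqP; rewrite eq_le measure_ge0 andbT.
apply/lee_addgt0Pr => e e0; rewrite add0e.
have [d d0 H] := acG e0.
have Noo : (mu N < +oo)%E by rewrite N0.
have [U [oU NU Ud]] := lebesgue_regularity_outer mN Noo d0.
have mU : measurable U by exact: open_measurable.
have {}Ud : (mu U < d%:E)%E.
  apply: le_lt_trans Ud; rewrite -[leRHS]add0e -[in leRHS]N0.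
  rewrite -[in leLHS](setDUK NU); apply: measureU2 => //.
  exact: measurableD.
have nuU : (nu U <= e%:E)%E.
  have cvgU : (nu \o inner_part U) n @[n --> \oo] --> nu U.
    rewrite -[in X in _ --> X](bigcup_inner_part oU).
    apply: nondecreasing_cvg_mu; first exact: inner_part_measurable.
      by rewrite (bigcup_inner_part oU).
    by move=> k m km; exact: inner_part_homo.
  rewrite -(cvg_lim _ cvgU)//; apply: lime_le; first by apply/cvg_ex; exists (nu U).
  by apply: nearW => n; exact: (nu_inner_part mU H Ud).
by apply: le_trans nuU; apply: le_measure; rewrite ?inE.
Qed.

(** By [nu_null], the Lebesgue-Stieltjes measure of [g] is dominated by the
    Lebesgue measure; [h] is its Radon-Nikodym derivative. *)
Lemma nondecreasing_ac_density : exists h : R -> R,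
  mu.-integrable setT (EFin \o h) /\
  forall x y, a <= x -> x <= y -> y <= b ->
    (\int[mu]_(r in `[x, y]) (h r)%:E = (g y - g x)%:E)%E.
Proof.
have mab : measurable (`]a, b]%classic : set (measurableTypeR R)).
  exact: (@measurable_itv R `]a, b]).
have nuoo : (nu `]a, b]%classic < +oo)%E by rewrite nu_itv// ltry.
pose nu' : {finite_measure set (measurableTypeR R) -> \bar R} := mfrestr mab nuoo.
have dom : nu' `<< mu.
  move=> N N0 A mA AN; rewrite /nu' /= /mfrestr /mrestr.
  apply/eqP; rewrite eq_le measure_ge0 andbT.
  rewrite -(nu_null mA (N0 _ mA AN)); apply: le_measure; rewrite ?inE//.
  exact: measurableI.
have [f [f0 ffin intf fE]] := radon_nikodym_sigma_finite dom.
exists (fine \o f).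
have fineE : EFin \o (fine \o f) = f.
  by apply/funext => r /=; rewrite fineK.
split; first by rewrite fineE.
move=> x y ax xy yb; rewrite -integral_itv_obnd_cbnd; last first.
  have := measurable_int _ intf.
  rewrite -[X in measurable_fun _ X]fineE.
  exact: measurable_funS.
under eq_integral do rewrite fineK//.
rewrite -fE//= /nu' /mfrestr /mrestr setIidl; last first.
  by move=> z /=; rewrite !in_itv/= => /andP[p q]; rewrite (le_lt_trans ax p) (le_trans q yb).
transitivity (nu `]x, y]%classic); first by [].
by rewrite nu_itv// /G /= !clamp_id// ?ax ?yb ?(le_trans ax xy) ?(le_trans xy yb).
Qed.

End nondecreasing_density.

Lemma derive1_cvg (R : realType) (V : normedModType R) (f : R -> V) (x : R) :
  derivable f x 1 ->
  h^-1 *: (f (h + x) - f x) @[h --> (0:R)^'] --> derive1 f x.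
Proof.
rewrite /derivable => cvg1; suff e : (fun h : R => h^-1 *: (f (h + x) - f x)) =
    (fun h : R => h^-1 *: (f (h *: 1 + x) - f x)) by rewrite /derive1 e.
by apply/funext => h; rewrite [h *: 1]mulr1.
Qed.

Lemma derivable_of_cvg (R : realType) (V : normedModType R) (f : R -> V) (x : R)
    (l : V) : h^-1 *: (f (h + x) - f x) @[h --> (0:R)^'] --> l ->
  derivable f x 1 /\ derive1 f x = l.
Proof.
move=> cvgl; split; last exact: cvg_lim cvgl.
apply/cvg_ex; exists l; apply: cvg_trans cvgl; apply: near_eq_cvg.
by apply: nearW => h; rewrite [h *: 1]mulr1.
Qed.

Section absolutely_continuous_FTC.
Context {R : realType}.
Variables (a b : R) (f : R -> R).
Hypotheses (ab : a <= b) (acf : abs_cont a b (f : R -> R^o)).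
Local Notation mu := (@lebesgue_measure R).

Lemma ac_density : exists h : R -> R,
  mu.-integrable setT (EFin \o h) /\
  forall x y, a <= x -> x <= y -> y <= b ->
    (\int[mu]_(r in `[x, y]) (h r)%:E = (f y - f x)%:E)%E.
Proof.
pose P := pos_variation a f.
have acP : ac_family a b P by exact: pos_variation_ac.
have ac_f : ac_family a b f by exact: abs_cont_family acf.
have Pge x y : a <= x -> x <= y -> y <= b ->
    P x <= P y /\ P x - f x <= P y - f y.
  move=> ax xy yb; have := pos_variation_ge ab acf ax xy yb; rewrite -/P.
  by case: (leP 0 (f y - f x)); lra.
have ndP x y : a <= x -> x <= y -> y <= b -> P x <= P y.
  by move=> ax xy /(Pge _ _ ax xy)[].
have ndPf x y : a <= x -> x <= y -> y <= b -> P x - f x <= P y - f y.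
  by move=> ax xy /(Pge _ _ ax xy)[].
have [h1 [int1 E1]] := nondecreasing_ac_density ab acP ndP.
have [h2 [int2 E2]] := nondecreasing_ac_density ab (ac_familyB acP ac_f) ndPf.
exists (fun r => h1 r - h2 r); split.
  rewrite (_ : EFin \o _ = (EFin \o h1) \- (EFin \o h2))%E; last by apply/funext.
  exact: integrableB.
move=> x y ax xy yb; under eq_integral do rewrite EFinB.
rewrite integralB//; [|exact: integrableS int1|exact: integrableS int2].
by rewrite E1// E2// -EFinB; congr EFin; lra.
Qed.

(** At the Lebesgue points of the density the indefinite integral has the
    density as derivative, and [f] differs from it by a constant. *)
Lemma ac_FTC : exists h : R -> R,
  [/\ mu.-integrable setT (EFin \o h),
      forall x y, a <= x -> x <= y -> y <= b ->
        (\int[mu]_(r in `[x, y]) (h r)%:E = (f y - f x)%:E)%E &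
      {ae mu, forall x, a < x < b -> derivable f x 1 /\ derive1 f x = h x}].
Proof.
have [h [inth hE]] := ac_density; exists h; split=> //.
have loch : locally_integrable [set: R] h.
  have := integrable_locally measurableT inth; rewrite patch_setT; exact.
have hint y : mu.-integrable [set` Interval (BLeft a) (BRight y)] (EFin \o h).
  exact: integrableS inth.
have := FTC1 hint loch; apply: filterS.
  exact: (ae_filter_ringOfSetsType mu).
move=> x + /andP[ax xb].
pose F y := (\int[mu]_(z in `[a, y]) h z)%R; case; first by rewrite /= lte_fin.
rewrite -/F => dF F'E.
rewrite -F'E; apply: derivable_of_cvg.
apply: cvg_trans (derive1_cvg dF); apply: near_eq_cvg; near=> k.
have /andP[ak kb] : a <= k + x <= b.
  have : `|k| < Num.min (x - a) (b - x).
    by near: k; apply: dnbhs0_lt; rewrite lt_min !subr_gt0 ax.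
  by rewrite lt_min !ltr_norml; lra.
rewrite /F /Rintegral !hE ?(ltW ax) ?(ltW xb)//=; congr (_ *: _); ring.
Unshelve. all: by end_near. Qed.

End absolutely_continuous_FTC.

(** * The flow rule of one variable as an equality case *)

Section dot_theory.
Context {R : realType} {k : nat}.
Implicit Types (x y z : 'cV[R]_k) (c : R) (B : 'M[R]_k).

Lemma dotC x y : dot x y = dot y x.
Proof. by apply: eq_bigr => i _; rewrite mulrC. Qed.

Lemma dotDl x y z : dot (x + y) z = dot x z + dot y z.
Proof. by rewrite -big_split; apply: eq_bigr => i _; rewrite mxE mulrDl. Qed.

Lemma dotZl c x y : dot (c *: x) y = c * dot x y.
Proof. by rewrite /dot mulr_sumr; apply: eq_bigr => i _; rewrite mxE mulrA. Qed.

Lemma dotNl x y : dot (- x) y = - dot x y.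
Proof. by rewrite -scaleN1r dotZl mulN1r. Qed.

Lemma dotDr x y z : dot x (y + z) = dot x y + dot x z.
Proof. by rewrite dotC dotDl !(dotC x). Qed.

Lemma dotZr c x y : dot x (c *: y) = c * dot x y.
Proof. by rewrite dotC dotZl dotC. Qed.

Lemma dotNr x y : dot x (- y) = - dot x y.
Proof. by rewrite dotC dotNl dotC. Qed.

Lemma dot0l y : dot 0 y = 0.
Proof. by rewrite -(scale0r 0) dotZl mul0r. Qed.

Lemma dot0r x : dot x 0 = 0.
Proof. by rewrite dotC dot0l. Qed.

Definition dotE := (dotDl, dotDr, dotZl, dotZr, dotNl, dotNr, dot0l, dot0r).

Lemma dot_ge0 x : 0 <= dot x x.
Proof. by apply: sumr_ge0 => i _; rewrite -expr2 sqr_ge0. Qed.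

Lemma dot_eq0 x : (dot x x == 0) = (x == 0).
Proof.
apply/eqP/eqP => [x0|->]; last by rewrite dot0l.
apply/colP => i; rewrite mxE; apply/eqP; rewrite -sqrf_eq0 expr2.
have /psumr_eq0P : forall j : 'I_k, true -> 0 <= x j 0 * x j 0.
  by move=> j _; rewrite -expr2 sqr_ge0.
by move=> /(_ x0 i isT) ->.
Qed.

Lemma sqr_enorm x : enorm x ^+ 2 = dot x x.
Proof. by rewrite sqr_sqrtr ?dot_ge0. Qed.

Lemma dot_mul_sym B x y : B^T = B -> dot (B *m x) y = dot (B *m y) x.
Proof.
move=> sB; have dotM (u v : 'cV[R]_k) : dot u v = (u^T *m v) 0 0.
  by rewrite mxE; apply: eq_bigr => i _; rewrite mxE.
by rewrite dotM trmx_mul sB -mulmxA -dotM dotC.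
Qed.

Lemma quadZ B c x : quad B (c *: x) = c ^+ 2 * quad B x.
Proof. by rewrite /quad -scalemxAr !dotE; ring. Qed.

Lemma quad0 B : quad B 0 = 0.
Proof. by rewrite /quad mulmx0 dot0l mulr0. Qed.

Lemma quadD B x y : B^T = B ->
  quad B (x + y) = quad B x + dot (B *m x) y + quad B y.
Proof.
by move=> sB; rewrite /quad mulmxDr !dotE (dot_mul_sym y x sB); lra.
Qed.

End dot_theory.

(** The dissipation potential is [f + quad B]: [f] is the rate-independent part
    ([R_0] for the variable [z], zero for [u]) and [B] the viscosity matrix. *)
Section flow_rule.
Context {R : realType} {k : nat}.
Variables (f : 'cV[R]_k -> R) (B : 'M[R]_k) (C : R).
Hypothesis f_ge0 : forall v, 0 <= f v.
Hypothesis f0 : f 0 = 0.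
Hypothesis f_hom : forall c v, 0 < c -> f (c *: v) = c * f v.
Hypothesis f_conv : forall s v w, 0 <= s <= 1 ->
  f (s *: v + (1 - s) *: w) <= s * f v + (1 - s) * f w.
Hypothesis symB : B^T = B.
Hypothesis C_gt0 : 0 < C.
Hypothesis B_coercive : forall v, C * enorm v ^+ 2 <= quad B v.
Implicit Types (v w y xi : 'cV[R]_k).

Local Notation conj := (conjugate_fun (fun v => f v + quad B v)).

Lemma quad_ge0 v : 0 <= quad B v.
Proof.
by apply: le_trans (B_coercive v); rewrite sqr_enorm mulr_ge0 ?dot_ge0// ltW.
Qed.

Lemma quad_eq0 v : (quad B v == 0) = (v == 0).
Proof.
apply/eqP/eqP => [q0|->]; last exact: quad0.
apply/eqP; rewrite -dot_eq0 eq_le dot_ge0 andbT.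
by have := B_coercive v; rewrite q0 sqr_enorm pmulr_rle0.
Qed.

Lemma conj_ge xi v : ((dot xi v - (f v + quad B v))%:E <= conj xi)%E.
Proof. by apply: ereal_sup_ubound; exists v. Qed.

Lemma conj_le xi c : (forall v, dot xi v - (f v + quad B v) <= c) ->
  (conj xi <= c%:E)%E.
Proof. by move=> h; apply: ge_ereal_sup => _ [v _ <-]; rewrite lee_fin. Qed.

Lemma conj_ge0 xi : (0 <= conj xi)%E.
Proof. by have := conj_ge xi 0; rewrite dot0r f0 quad0 addr0 subrr. Qed.

(** The coercivity of [quad B] bounds the conjugate by [dot xi xi / (4 * C)]. *)
Lemma conj_fin_num xi : conj xi \is a fin_num.
Proof.
rewrite ge0_fin_numE ?conj_ge0//.
suff /conj_le/le_lt_trans : forall v,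
    dot xi v - (f v + quad B v) <= dot xi xi / (4 * C) by apply; rewrite ltry.
move=> v; have := B_coercive v; rewrite sqr_enorm; have := f_ge0 v.
have := dot_ge0 (xi - (2 * C) *: v); rewrite !dotE (dotC v xi).
rewrite ler_pdivlMr ?mulr_gt0//.
move: (dot xi xi) (dot xi v) (dot v v) (quad B v) (f v) => a b d q r.
move=> h1 r0 qd; have : 0 <= C * (q - C * d) by rewrite mulr_ge0 ?subr_ge0// ltW.
have : 0 <= C * r by rewrite mulr_ge0// ltW.
nra.
Qed.

Definition kappa xi : R := fine (conj xi).

Lemma kappaE xi : conj xi = (kappa xi)%:E.
Proof. by rewrite /kappa fineK// conj_fin_num. Qed.

Lemma kappa_ge0 xi : 0 <= kappa xi.
Proof. by rewrite -lee_fin -kappaE conj_ge0. Qed.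

Lemma kappa_ge xi v : dot xi v - (f v + quad B v) <= kappa xi.
Proof. by rewrite -lee_fin -kappaE conj_ge. Qed.

Definition contact_bound xi v : R :=
  2 * Num.sqrt (quad B v) * Num.sqrt (kappa xi).

(** Optimizing the Fenchel inequality over the dilations of [v] replaces the sum
    of potential and conjugate by twice the geometric mean of the quadratic part
    and the conjugate; [f], being homogeneous, scales like the linear term. *)
Lemma contact_le xi v : dot xi v - f v <= contact_bound xi v.
Proof.
have bnd_ge0 : 0 <= contact_bound xi v by rewrite !mulr_ge0// sqrtr_ge0.
have [v0|v_neq0] := eqVneq v 0; first by rewrite {1 2}v0 dot0r f0 subrr.
have [x0|x0] := leP (dot xi v - f v) 0; first exact: le_trans bnd_ge0.
have q0 : 0 < quad B v by rewrite lt_neqAle eq_sym quad_eq0 v_neq0 quad_ge0.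
rewrite -(@ler_pXn2r _ 2)// ?nnegrE ?(ltW x0)//.
rewrite /contact_bound !exprMn !sqr_sqrtr ?quad_ge0 ?kappa_ge0//.
(* the optimal dilation of the velocity *)
pose l := (dot xi v - f v) / (2 * quad B v).
have l0 : 0 < l by rewrite divr_gt0// mulr_gt0.
have lE : l * (2 * quad B v) = dot xi v - f v.
  by rewrite divfK// mulf_neq0// gt_eqF.
have := kappa_ge xi (l *: v); rewrite dotZr f_hom// quadZ.
rewrite -lE opprD addrA -mulrBr -lE => le_k.
have : 0 <= quad B v * (kappa xi - l ^+ 2 * quad B v).
  by rewrite mulr_ge0 ?quad_ge0// subr_ge0; nra.
by rewrite exprMn; nra.
Qed.

(** First-order optimality: [quad B] is differentiable with gradient [B *m v],
    and only its gradient matters along a short segment. *)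
Lemma kappa_maximizer_subdiff xi v :
  dot xi v - (f v + quad B v) = kappa xi -> subdiff f v (xi - B *m v).
Proof.
move=> maxv w; rewrite -subr_ge0 leNgt; apply/negP.
set D := (X in X < 0) => D0.
(* the second-order term is negligible along the segment from v to w *)
pose s := Num.min 1 (- D / (2 * (quad B (w - v) + 1))).
have q0 := quad_ge0 (w - v).
have den0 : 0 < 2 * (quad B (w - v) + 1) by lra.
have s01 : 0 < s <= 1.
  by rewrite lt_min ltr01 divr_gt0 ?oppr_gt0//= ge_min lexx.
have sq : s * (2 * (quad B (w - v) + 1)) <= - D.
  by rewrite -ler_pdivlMr// ge_min lexx orbT.
have := kappa_ge xi (v + s *: (w - v)); rewrite -maxv quadD// quadZ.
have : f (v + s *: (w - v)) <= s * f w + (1 - s) * f v.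
  rewrite (_ : v + _ = s *: w + (1 - s) *: v); last first.
    by rewrite scalerBr scalerBl scale1r addrCA addrA addrAC.
  by apply: f_conv; lra.
move: sq D0; rewrite /D !dotE.
move: (dot xi w) (dot xi v) (dot (B *m v) w) (dot (B *m v) v) q0 => a b c d q0.
by move: s01 => /andP[]; nra.
Qed.

Lemma subdiff_hom v w : subdiff f v w ->
  dot w v = f v /\ forall y, dot w y <= f y.
Proof.
move=> sw; have e : dot w v = f v.
  have := sw (2 *: v); have := sw 0; rewrite f_hom// f0 !dotE; lra.
by split=> // y; have := sw y; rewrite !dotE e; lra.
Qed.

(** In the equality case the dilation [l *: v] that is optimal in [contact_le]
    attains the supremum [kappa xi], hence is a maximizer. *)
Lemma contact_eq_subdiff xi v : v != 0 -> dot xi v - f v = contact_bound xi v ->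
  subdiff f v (xi - (Num.sqrt (kappa xi) / Num.sqrt (quad B v)) *: (B *m v)).
Proof.
move=> v0 eqv; have q0 : 0 < quad B v by rewrite lt_neqAle eq_sym quad_eq0 v0 quad_ge0.
have sq0 : 0 < Num.sqrt (quad B v) by rewrite sqrtr_gt0.
set l := _ / _; have l_ge0 : 0 <= l by rewrite divr_ge0 ?sqrtr_ge0.
have lE : l * Num.sqrt (quad B v) = Num.sqrt (kappa xi) by rewrite divfK// gt_eqF.
have qE : Num.sqrt (quad B v) ^+ 2 = quad B v by rewrite sqr_sqrtr// ltW.
have kE : Num.sqrt (kappa xi) ^+ 2 = kappa xi by rewrite sqr_sqrtr// kappa_ge0.
move: eqv; rewrite /contact_bound => eqv.
have [l0|l_neq0] := eqVneq l 0.
  rewrite l0 scale0r subr0 => w; have := contact_le xi w.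
  by rewrite /contact_bound -lE l0 mul0r mulr0 dotDr dotNr; move: eqv; rewrite -lE l0; lra.
have l_gt0 : 0 < l by rewrite lt_neqAle eq_sym l_neq0.
have /kappa_maximizer_subdiff sub : dot xi (l *: v) - (f (l *: v) + quad B (l *: v)) = kappa xi.
  rewrite dotZr f_hom// quadZ -kE -lE; move: qE eqv; rewrite -lE.
  move: (Num.sqrt (quad B v)) => r <- eqv.
  have -> : dot xi v = f v + 2 * r * (l * r) by lra.
  ring.
move=> w; have := sub (l *: w); rewrite !f_hom// -scalerBr dotZr -mulrDr ler_pM2l//.
by rewrite scalemxAr.
Qed.

(** Conversely, the supremum is attained at [l *: v]: by homogeneity [w] is also
    a subgradient there, and completing the square compares with any other
    velocity. *)
Lemma subdiff_contact xi v w l : 0 <= l -> subdiff f v w ->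
  xi = w + l *: (B *m v) ->
  dot xi v - f v = 2 * l * quad B v /\ kappa xi = l ^+ 2 * quad B v.
Proof.
move=> l0 /subdiff_hom[wv wle] ->.
have xiv : dot (w + l *: (B *m v)) v - f v = 2 * l * quad B v.
  by rewrite !dotE wv /quad; lra.
split=> //; apply/eqP; rewrite eq_le; apply/andP; split.
  rewrite -lee_fin -kappaE; apply: conj_le => y.
  have := quad_ge0 (y + (- l) *: v); rewrite quadD// quadZ sqrrN.
  rewrite !dotE (dot_mul_sym _ _ symB); have := wle y; lra.
have [->|l_neq0] := eqVneq l 0.
  by rewrite expr0n mul0r kappa_ge0.
have l_gt0 : 0 < l by rewrite lt_neqAle eq_sym l_neq0.
have := kappa_ge (w + l *: (B *m v)) (l *: v).
rewrite f_hom// dotZr quadZ; move: xiv; move: (dot _ v) => d xiv; nra.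
Qed.

(** For [theta < 1] the rule reads [xi = w + l *: (B *m v)] with
    [l = theta / (1 - theta)] and [w] a subgradient at [v]; for [theta = 1] it
    forces [v = 0]. *)
Lemma flow_ruleP theta xi v : 0 <= theta <= 1 ->
  (exists2 w, scale_set (1 - theta) (subdiff f v) w &
     w + theta *: (B *m v) - (1 - theta) *: xi = 0) <->
  dot xi v - f v = contact_bound xi v /\
  (1 - theta) * Num.sqrt (kappa xi) = theta * Num.sqrt (quad B v).
Proof.
move=> /andP[t0 t1]; rewrite /scale_set; split.
  move=> [w]; have [|theta_neq1] := eqVneq (1 - theta) 0.
    move=> th1 -> ; rewrite th1 scale0r subr0 add0r.
    have -> : theta = 1 by lra.
    rewrite scale1r => Bv0; have v0 : v = 0.
      by apply/eqP; rewrite -quad_eq0 /quad Bv0 dot0l mulr0.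
    by rewrite /contact_bound v0 quad0 sqrtr0 dot0r f0; split; ring.
  have th_gt0 : 0 < 1 - theta by rewrite lt_neqAle eq_sym theta_neq1/=; lra.
  move=> [w' sw <-{w}] eq0.
  pose l := theta / (1 - theta).
  have l0 : 0 <= l by rewrite divr_ge0// ltW.
  have lE : (1 - theta) * l = theta by rewrite mulrC divfK.
  have xiE : xi = w' + l *: (B *m v).
    apply: (scalerI theta_neq1); apply/eqP; rewrite eq_sym -subr_eq0.
    by rewrite scalerDr scalerA lE eq0.
  have [-> kE] := subdiff_contact l0 sw xiE.
  rewrite /contact_bound kE [Num.sqrt (l ^+ 2 * _)]sqrtrM ?sqr_ge0// sqrtr_sqr.
  rewrite ger0_norm//.
  split; last by rewrite mulrA lE.
  have := sqr_sqrtr (quad_ge0 v); move: (Num.sqrt _) => r <-; ring.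
move=> [eqv eqth]; have [th1|theta_neq1] := eqVneq (1 - theta) 0.
  exists 0 => //; rewrite th1 scale0r subr0 add0r.
  have th_eq1 : theta = 1 by lra.
  move: eqth; rewrite th1 th_eq1 mul0r mul1r => /esym/eqP.
  rewrite sqrtr_eq0 => qle0; have /eqP -> : v == 0.
    by rewrite -quad_eq0 eq_le qle0 quad_ge0.
  by rewrite mulmx0 scaler0.
have th_gt0 : 0 < 1 - theta by rewrite lt_neqAle eq_sym theta_neq1/=; lra.
have [v0|v_neq0] := eqVneq v 0.
  have k0 : kappa xi = 0.
    move: eqth; rewrite v0 quad0 sqrtr0 mulr0 => /eqP.
    rewrite mulf_eq0 (negbTE theta_neq1)/= sqrtr_eq0 => kle.
    by apply/eqP; rewrite eq_le kle kappa_ge0.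
  exists ((1 - theta) *: xi); last by rewrite v0 mulmx0 scaler0 addr0 subrr.
  exists xi => // w; rewrite v0 f0 add0r subr0.
  by have := contact_le xi w; rewrite /contact_bound k0 sqrtr0 mulr0 subr_le0.
have q0 : 0 < quad B v by rewrite lt_neqAle eq_sym quad_eq0 v_neq0 quad_ge0.
have sq0 : Num.sqrt (quad B v) != 0 by rewrite gt_eqF// sqrtr_gt0.
have lE : (1 - theta) * (Num.sqrt (kappa xi) / Num.sqrt (quad B v)) = theta.
  by rewrite mulrA eqth mulfK.
have := contact_eq_subdiff v_neq0 eqv; set l := _ / _ => sub.
exists ((1 - theta) *: (xi - l *: (B *m v))); first by exists (xi - l *: (B *m v)).
by rewrite scalerBr scalerA lE subrK subrr.
Qed.

End flow_rule.

(** * The reduced contact potential and the switching conditions *)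

Section reduced_potential.
Context {R : realType}.
Implicit Types (alpha tau a b p r : R).

(** The reduced contact potential only sees the four numbers
    [a = V_u(u')], [b = V_z(z')], [p = V_u^*(eta)], [r = W_z^*(zeta)]. *)
Definition red_potential alpha tau a b p r : \bar R :=
  (if (0 < tau)%R then
     if (r == 0)%R && (p == 0)%R then 0 else +oo
   else if (1 < alpha)%R then
     if (b == 0)%R then (2 * Num.sqrt a * Num.sqrt p)%:E
     else if (p == 0)%R then (2 * Num.sqrt b * Num.sqrt r)%:E
     else +oo
   else if (alpha == 1)%R then (2 * Num.sqrt (b + a) * Num.sqrt (r + p))%:E
   else
     if (r == 0)%R then (2 * Num.sqrt a * Num.sqrt p)%:E
     else if (a == 0)%R then (2 * Num.sqrt b * Num.sqrt r)%:E
     else +oo)%E.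

Definition balance a b p r : R :=
  2 * Num.sqrt a * Num.sqrt p + 2 * Num.sqrt b * Num.sqrt r.

Definition switch alpha tau tu tz : Prop :=
  (tau * tu = 0 /\ tau * tz = 0) /\
  [/\ 1 < alpha -> tu * (1 - tz) = 0,
      alpha = 1 -> tu = tz &
      alpha < 1 -> tz * (1 - tu) = 0].

(** Lagrange's identity: the Cauchy-Schwarz defect is the second square. *)
Lemma sqrt_sum_mul a b p r : 0 <= a -> 0 <= b -> 0 <= p -> 0 <= r ->
  2 * Num.sqrt (b + a) * Num.sqrt (r + p) = 2 * Num.sqrt (
    (Num.sqrt a * Num.sqrt p + Num.sqrt b * Num.sqrt r) ^+ 2 +
    (Num.sqrt a * Num.sqrt r - Num.sqrt b * Num.sqrt p) ^+ 2).
Proof.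
move=> a0 b0 p0 r0; rewrite -mulrA -sqrtrM ?addr_ge0//; congr (_ * Num.sqrt _).
rewrite -{1}(sqr_sqrtr a0) -{1}(sqr_sqrtr b0) -{1}(sqr_sqrtr p0).
by rewrite -{1}(sqr_sqrtr r0); ring.
Qed.

Lemma red_potential_ge alpha tau a b p r :
  0 <= a -> 0 <= b -> 0 <= p -> 0 <= r ->
  ((balance a b p r)%:E <= red_potential alpha tau a b p r)%E.
Proof.
move=> a0 b0 p0 r0; rewrite /red_potential /balance.
case: ifP => _.
  case: ifP => [/andP[/eqP-> /eqP->]|_]; last exact: leey.
  by rewrite sqrtr0 !mulr0 addr0.
case: ifP => _.
  case: eqP => [->|_]; first by rewrite sqrtr0 mulr0 mul0r addr0.
  case: eqP => [->|_]; last exact: leey.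
  by rewrite sqrtr0 mulr0 add0r.
case: ifP => _.
  rewrite lee_fin sqrt_sum_mul// -!mulrA -mulrDr ler_pM2l//.
  rewrite -[leLHS]ger0_norm; last by rewrite addr_ge0// mulr_ge0 ?sqrtr_ge0.
  by rewrite -sqrtr_sqr ler_wsqrtr// lerDl sqr_ge0.
case: eqP => [->|_]; first by rewrite sqrtr0 !mulr0 addr0.
case: eqP => [->|_]; last exact: leey.
by rewrite sqrtr0 mulr0 mul0r add0r.
Qed.

(** The switching conditions exclude the branches in which the potential is
    infinite, and annihilate one of the two products when [alpha <> 1]. For
    [alpha = 1] the common parameter makes the pairs [(sqrt a, sqrt b)] and
    [(sqrt p, sqrt r)] parallel, so that the Cauchy-Schwarz defect vanishes. *)
Lemma red_potential_balance alpha tau a b p r tu tz :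
  0 <= a -> 0 <= b -> 0 <= p -> 0 <= r ->
  (1 - tu) * Num.sqrt p = tu * Num.sqrt a ->
  (1 - tz) * Num.sqrt r = tz * Num.sqrt b ->
  switch alpha tau tu tz ->
  red_potential alpha tau a b p r = (balance a b p r)%:E.
Proof.
move=> a0 b0 p0 r0 eu ez [[tau_u tau_z] [gt1 eq1 lt1]].
rewrite /red_potential /balance.
have sqrt0 (x : R) : 0 <= x -> Num.sqrt x = 0 -> x = 0.
  by move=> x0 /eqP; rewrite sqrtr_eq0 => xle; apply/eqP; rewrite eq_le xle.
have case0 (x y : R) : x * y = 0 -> x = 0 \/ y = 0.
  by move/eqP; rewrite mulf_eq0 => /orP[]/eqP->; [left|right].
have u0 : tu = 0 -> p = 0.
  by move=> t0; move: eu; rewrite t0 subr0 mul1r mul0r => /(sqrt0 _ p0).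
have z0 : tz = 0 -> r = 0.
  by move=> t0; move: ez; rewrite t0 subr0 mul1r mul0r => /(sqrt0 _ r0).
have u1 : 1 - tu = 0 -> a = 0.
  move=> t1; move: eu; rewrite t1 mul0r (_ : tu = 1) ?mul1r; last lra.
  by move=> /esym/(sqrt0 _ a0).
have z1 : 1 - tz = 0 -> b = 0.
  move=> t1; move: ez; rewrite t1 mul0r (_ : tz = 1) ?mul1r; last lra.
  by move=> /esym/(sqrt0 _ b0).
case: ifP => [tau0|_].
  have tau_neq0 : tau <> 0 by lra.
  have -> : p = 0 by case: (case0 _ _ tau_u) => // /u0.
  have -> : r = 0 by case: (case0 _ _ tau_z) => // /z0.
  by rewrite !eqxx sqrtr0 !mulr0 addr0.
case: ltP => [/gt1|alpha_le1].
  case/case0 => [/u0->|/z1->].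
    rewrite sqrtr0 !mulr0 add0r eqxx; case: eqP => // ->.
    by rewrite sqrtr0 mulr0 mul0r.
  by rewrite eqxx sqrtr0 mulr0 mul0r addr0.
case: eqP => [/eq1 tuz|alpha_neq1].
  rewrite sqrt_sum_mul//.
  have -> : Num.sqrt a * Num.sqrt r - Num.sqrt b * Num.sqrt p = 0.
    subst tz; have [t1|t_neq1] := eqVneq (1 - tu) 0.
      by rewrite (u1 t1) (z1 t1) sqrtr0 !mul0r subrr.
    apply: (mulfI t_neq1); rewrite mulr0 mulrBr mulrCA ez.
    by rewrite (mulrCA _ (Num.sqrt b)) eu; ring.
  rewrite expr0n addr0 sqrtr_sqr ger0_norm.
    by congr EFin; ring.
  by rewrite addr_ge0// mulr_ge0 ?sqrtr_ge0.
have /lt1 : alpha < 1 by rewrite lt_neqAle alpha_le1 andbT; exact/eqP.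
case/case0 => [/z0->|/u1->].
  by rewrite eqxx sqrtr0 !mulr0 addr0.
rewrite eqxx sqrtr0 mulr0 mul0r add0r; case: eqP => // ->.
by rewrite sqrtr0 !mulr0.
Qed.

(** The solution [theta] of [(1 - theta) * sqrt p = theta * sqrt a]; when both
    square roots vanish any [theta] solves it, and [0] is the value that is
    compatible with a moving time. *)
Definition ratio p a : R :=
  if p == 0 then 0 else Num.sqrt p / (Num.sqrt p + Num.sqrt a).

(** The value [1] freezes a variable. For [alpha <> 1] the slower variable ([z]
    if [1 < alpha], else [u]) is frozen as long as the faster one is out of
    equilibrium; for [alpha = 1] a single ratio serves both variables. *)
Definition theta_u alpha a b p r : R :=
  if 1 < alpha then ratio p a
  else if alpha == 1 then ratio (r + p) (b + a)
  else if r == 0 then ratio p a else 1.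

Definition theta_z alpha a b p r : R :=
  if 1 < alpha then if p == 0 then ratio r b else 1
  else if alpha == 1 then ratio (r + p) (b + a)
  else ratio r b.

Lemma ratio_ge0_le1 p a : 0 <= p -> 0 <= a -> 0 <= ratio p a <= 1.
Proof.
move=> p0 a0; rewrite /ratio; case: eqP => [_|/eqP p_neq0]; first by rewrite lexx ler01.
have sp : 0 < Num.sqrt p by rewrite sqrtr_gt0 lt_neqAle eq_sym p_neq0.
have den : 0 < Num.sqrt p + Num.sqrt a by rewrite ltr_pwDl ?sqrtr_ge0.
by rewrite divr_ge0 ?(ltW den) ?(ltW sp)//= ler_pdivrMr// mul1r lerDl sqrtr_ge0.
Qed.

Lemma ratioE p a : 0 <= p -> 0 <= a ->
  (1 - ratio p a) * Num.sqrt p = ratio p a * Num.sqrt a.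
Proof.
move=> p0 a0; rewrite /ratio; case: eqP => [->|/eqP p_neq0].
  by rewrite sqrtr0 mulr0 mul0r.
have sp : 0 < Num.sqrt p by rewrite sqrtr_gt0 lt_neqAle eq_sym p_neq0.
have den : Num.sqrt p + Num.sqrt a != 0.
  by rewrite gt_eqF// ltr_pwDl ?sqrtr_ge0.
by field.
Qed.

Lemma theta_u_ge0_le1 alpha a b p r : 0 <= a -> 0 <= b -> 0 <= p -> 0 <= r ->
  0 <= theta_u alpha a b p r <= 1.
Proof.
move=> a0 b0 p0 r0; rewrite /theta_u.
by do ![case: ifP => _]; rewrite ?ratio_ge0_le1 ?addr_ge0 ?ler01 ?lexx.
Qed.

Lemma theta_z_ge0_le1 alpha a b p r : 0 <= a -> 0 <= b -> 0 <= p -> 0 <= r ->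
  0 <= theta_z alpha a b p r <= 1.
Proof.
move=> a0 b0 p0 r0; rewrite /theta_z.
by do ![case: ifP => _]; rewrite ?ratio_ge0_le1 ?addr_ge0 ?ler01 ?lexx.
Qed.

(** Here the finiteness of the potential gives back the conditions: a moving time
    forces [p = r = 0], and for [alpha <> 1] the faster variable is in
    equilibrium or the slower one is at rest. For [alpha = 1] equality in
    Cauchy-Schwarz makes the ratios of the two variables agree. *)
Lemma balance_switch alpha tau a b p r :
  0 <= tau -> 0 <= a -> 0 <= b -> 0 <= p -> 0 <= r ->
  red_potential alpha tau a b p r = (balance a b p r)%:E ->
  let tu := theta_u alpha a b p r in let tz := theta_z alpha a b p r in
  [/\ (1 - tu) * Num.sqrt p = tu * Num.sqrt a,
      (1 - tz) * Num.sqrt r = tz * Num.sqrt b &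
      switch alpha tau tu tz].
Proof.
move=> tau0 a0 b0 p0 r0; rewrite /red_potential /switch /balance /theta_u /theta_z.
have ratio0 x : ratio 0 x = 0 by rewrite /ratio eqxx.
case: ifP => [tau_gt0|tau_le0].
  case: ifP => [/andP[/eqP-> /eqP->] _|//].
  rewrite !eqxx !ratio0 sqrtr0 !addr0 !ratio0.
  case: ifP => _; first by rewrite !mulr0 !mul0r; do 2?split=> //; rewrite ?mul0r.
  case: ifP => _; by rewrite !mulr0 !mul0r; do 2?split=> //; rewrite ?mul0r.
have -> : tau = 0 by lra.
rewrite !mul0r.
case: ltgtP => alpha1 /=.
- case: (eqVneq b 0) => [->|b_neq0].
    move=> _; rewrite sqrtr0; case: (eqVneq p 0) => [->|p_neq0].
      rewrite ratio0 sqrtr0 !mulr0 !mul0r.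
      have := ratioE r0 (lexx 0); rewrite sqrtr0 mulr0 => ->.
      by repeat split=> *; lra.
    by rewrite ratioE// subrr mul0r; repeat split=> *; lra.
  case: (eqVneq p 0) => [->|//] _.
  rewrite ratio0 !mul0r sqrtr0 mulr0 ratioE//.
  by repeat split=> *; lra.
- case: (eqVneq r 0) => [->|r_neq0].
    move=> _; rewrite ratioE// ratio0 sqrtr0 !mulr0 !mul0r.
    by repeat split=> *; lra.
  case: (eqVneq a 0) => [->|//] _.
  rewrite sqrtr0 subrr mulr0 mul0r ratioE//.
  by repeat split=> *; lra.
- rewrite sqrt_sum_mul// => -[eqs].
  set A := Num.sqrt a in eqs *; set B := Num.sqrt b in eqs *.
  set P := Num.sqrt p in eqs *; set Q := Num.sqrt r in eqs *.
  have cs : A * Q = B * P.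
    have /(congr1 (fun x => x ^+ 2)) : Num.sqrt ((A * P + B * Q) ^+ 2 + (A * Q - B * P) ^+ 2) = A * P + B * Q by lra.
    rewrite sqr_sqrtr ?addr_ge0 ?sqr_ge0// => /eqP; rewrite -subr_eq0 addrAC subrr add0r.
    by rewrite sqrf_eq0 subr_eq0 => /eqP.
  have AE : A ^+ 2 = a by rewrite sqr_sqrtr.
  have BE : B ^+ 2 = b by rewrite sqr_sqrtr.
  have PE : P ^+ 2 = p by rewrite sqr_sqrtr.
  have QE : Q ^+ 2 = r by rewrite sqr_sqrtr.
  have rp0 : 0 <= r + p by rewrite addr_ge0.
  have ba0 : 0 <= b + a by rewrite addr_ge0.
  have sE : Num.sqrt (b + a) * P = Num.sqrt (r + p) * A.
    rewrite /P /A -!sqrtrM//; congr Num.sqrt.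
    by rewrite -AE -BE -PE -QE; move: cs => /(congr1 (fun x => x ^+ 2)); rewrite !exprMn; lra.
  have sE' : Num.sqrt (b + a) * Q = Num.sqrt (r + p) * B.
    rewrite /Q /B -!sqrtrM//; congr Num.sqrt.
    by rewrite -AE -BE -PE -QE; move: cs => /(congr1 (fun x => x ^+ 2)); rewrite !exprMn; lra.
  suff [e1 e2] : (1 - ratio (r + p) (b + a)) * P = ratio (r + p) (b + a) * A /\
      (1 - ratio (r + p) (b + a)) * Q = ratio (r + p) (b + a) * B.
    by repeat split=> *; lra.
  rewrite /ratio; case: eqP => [rp|/eqP rp_neq0].
    have [r_0 p_0] : r = 0 /\ p = 0 by split; lra.
    by rewrite /P /Q r_0 p_0 sqrtr0 !mulr0 !mul0r.
  have sp : 0 < Num.sqrt (r + p) by rewrite sqrtr_gt0 lt_neqAle eq_sym rp_neq0.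
  have den : Num.sqrt (r + p) + Num.sqrt (b + a) != 0.
    by rewrite gt_eqF// ltr_pwDl ?sqrtr_ge0.
  move: sE sE' den; move: (Num.sqrt (r + p)) (Num.sqrt (b + a)) => x y sE sE' den.
  have -> : 1 - x / (x + y) = y / (x + y) by field.
  by split; rewrite mulrAC ?sE ?sE' mulrAC.
Qed.

End reduced_potential.

(** * Pointwise equivalence of contact and flow rules *)

Section contact_potential.
Context {R : realType} {n m : nat}.
Variables (alpha : R) (R0 : state R n m -> 'cV[R]_m -> R).
Variables (Vz : state R n m -> 'M[R]_m) (Vu : state R n m -> 'M[R]_n).
Hypotheses (hR0 : assumption_R0 R0).
Hypotheses (hVz : assumption_V Vz) (hVu : assumption_V Vu).
Implicit Types (q xi : state R n m) (tau : R).

Lemma R0_ge0 q v : 0 <= R0 q v.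
Proof.
have [_ _ _ [C0 [C1 [C0_gt0 _ H]]]] := hR0; have /andP[+ _] := H q v.
by apply: le_trans; rewrite mulr_ge0 ?sqrtr_ge0// ltW.
Qed.

Lemma R0_0 q : R0 q 0 = 0.
Proof.
have [_ _ _ [C0 [C1 [_ _ H]]]] := hR0; have := H q 0.
by rewrite /enorm dot0l sqrtr0 !mulr0 => le0; apply: le_anti; rewrite andbC.
Qed.

Lemma R0_hom q c v : 0 < c -> R0 q (c *: v) = c * R0 q v.
Proof. by case: hR0 => _ _ H _; exact: H. Qed.

Lemma R0_conv q s v w : 0 <= s <= 1 ->
  R0 q (s *: v + (1 - s) *: w) <= s * R0 q v + (1 - s) * R0 q w.
Proof.
case: hR0 => _ H _ _ /andP[s0 s1].
by have := H q (Itv01 s0 s1) v w; rewrite !inE; apply.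
Qed.

Lemma V_sym k (A : state R n m -> 'M[R]_k) q : assumption_V A -> (A q)^T = A q.
Proof. by case. Qed.

Lemma V_coercive k (A : state R n m -> 'M[R]_k) : assumption_V A ->
  exists2 C, 0 < C & forall q v, C * enorm v ^+ 2 <= quad (A q) v.
Proof.
by case=> _ _ [C0 [C1 [C0_gt0 _ H]]]; exists C0 => // q v; case/andP: (H q v).
Qed.

Definition Vu_star q eta : R := kappa (fun=> 0) (Vu q) eta.
Definition Wz_star q zeta : R := kappa (R0 q) (Vz q) zeta.

Lemma Vu_conjE q eta : Vu_conj Vu q eta = (Vu_star q eta)%:E.
Proof.
have [C C0 HC] := V_coercive hVu.
rewrite -(@kappaE _ _ _ _ C)//.
by rewrite /Vu_conj; congr (conjugate_fun _ _); apply/funext => v; rewrite add0r.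
Qed.

Lemma Wz_conjE q zeta : Wz_conj R0 Vz q zeta = (Wz_star q zeta)%:E.
Proof.
have [C C0 HC] := V_coercive hVz.
by rewrite -(@kappaE _ _ _ _ C)//; [exact: R0_ge0|exact: R0_0].
Qed.

Lemma Vu_star_ge0 q eta : 0 <= Vu_star q eta.
Proof. by have [C C0 HC] := V_coercive hVu; apply: (@kappa_ge0 _ _ _ _ C). Qed.

Lemma Wz_star_ge0 q zeta : 0 <= Wz_star q zeta.
Proof.
have [C C0 HC] := V_coercive hVz.
by apply: (@kappa_ge0 _ _ _ _ C) => //; [exact: R0_ge0|exact: R0_0].
Qed.

Lemma quad_V_ge0 k (A : state R n m -> 'M[R]_k) q v :
  assumption_V A -> 0 <= quad (A q) v.
Proof. by move=> /V_coercive[C C0 HC]; exact: quad_ge0 C0 (HC q) v. Qed.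

Lemma M0_redE q tau (q' : state R n m) xi : M0_red alpha R0 Vz Vu q tau q' xi =
  red_potential alpha tau (quad (Vu q) q'.1) (quad (Vz q) q'.2)
    (Vu_star q xi.1) (Wz_star q xi.2).
Proof. by rewrite /M0_red Vu_conjE Wz_conjE. Qed.

Local Notation power xi q' := (dot xi.1 q'.1 + dot xi.2 q'.2).

Lemma contact_le_u q eta v : dot eta v <=
  2 * Num.sqrt (quad (Vu q) v) * Num.sqrt (Vu_star q eta).
Proof.
have [C C0 HC] := V_coercive hVu; rewrite -[leLHS]subr0.
by apply: (@contact_le _ _ (fun=> 0) _ C) => // c w _; rewrite mulr0.
Qed.

Lemma contact_le_z q zeta v : dot zeta v - R0 q v <=
  2 * Num.sqrt (quad (Vz q) v) * Num.sqrt (Wz_star q zeta).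
Proof.
have [C C0 HC] := V_coercive hVz.
apply: (@contact_le _ _ _ _ C) => //.
- exact: R0_ge0.
- exact: R0_0.
- exact: R0_hom.
Qed.

Lemma M0_ge q tau (q' : state R n m) xi :
  ((power xi q')%:E <= M0 alpha R0 Vz Vu q tau q' xi)%E.
Proof.
rewrite /M0 M0_redE.
set a := quad (Vu q) _; set b := quad (Vz q) _; set p := Vu_star _ _; set r := Wz_star _ _.
have := @red_potential_ge R alpha tau a b p r (quad_V_ge0 _ _ hVu)
  (quad_V_ge0 _ _ hVz) (Vu_star_ge0 _ _) (Wz_star_ge0 _ _).
move=> /(leeD2l (R0 q q'.2)%:E); apply: le_trans; rewrite -EFinD lee_fin /balance.
have := contact_le_u q xi.1 q'.1; have := contact_le_z q xi.2 q'.2.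
rewrite -/a -/b -/p -/r; lra.
Qed.

(** Equality in [M0_ge] decouples into equality for each variable and equality
    in [red_potential_ge]. *)
Lemma M0_eqP q tau (q' : state R n m) xi :
  M0 alpha R0 Vz Vu q tau q' xi = (power xi q')%:E <->
  [/\ dot xi.1 q'.1 =
        2 * Num.sqrt (quad (Vu q) q'.1) * Num.sqrt (Vu_star q xi.1),
      dot xi.2 q'.2 - R0 q q'.2 =
        2 * Num.sqrt (quad (Vz q) q'.2) * Num.sqrt (Wz_star q xi.2) &
      red_potential alpha tau (quad (Vu q) q'.1) (quad (Vz q) q'.2)
        (Vu_star q xi.1) (Wz_star q xi.2) =
      (balance (quad (Vu q) q'.1) (quad (Vz q) q'.2)
        (Vu_star q xi.1) (Wz_star q xi.2))%:E].
Proof.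
rewrite /M0 M0_redE.
have := contact_le_u q xi.1 q'.1; have := contact_le_z q xi.2 q'.2.
set a := quad (Vu q) _; set b := quad (Vz q) _; set p := Vu_star _ _; set r := Wz_star _ _.
have := @red_potential_ge R alpha tau a b p r (quad_V_ge0 _ _ hVu)
  (quad_V_ge0 _ _ hVz) (Vu_star_ge0 _ _) (Wz_star_ge0 _ _).
move=> ge_bal le_z le_u; split=> [|[eu ez ->]]; last first.
  by rewrite -EFinD; congr EFin; rewrite /balance -eu -ez; ring.
move: ge_bal; case: red_potential => [x| |]//=.
rewrite lee_fin /balance -EFinD => ge_bal [xE].
by split; [lra|lra|congr EFin; lra].
Qed.

Definition flow_conditions q tau (q' D : state R n m) (tu tz : R) : Prop :=
  [/\ tu *: (Vu q *m q'.1) + (1 - tu) *: D.1 = 0,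
      exists2 w : 'cV[R]_m, scale_set (1 - tz) (subdiff (R0 q) q'.2) w &
        w + tz *: (Vz q *m q'.2) + (1 - tz) *: D.2 = 0,
      tau * tu = 0 /\ tau * tz = 0 &
      [/\ 1 < alpha -> tu * (1 - tz) = 0,
          alpha = 1 -> tu = tz &
          alpha < 1 -> tz * (1 - tu) = 0]].

(** The subdifferential of the zero potential is trivial, which turns the flow
    rule for [u] into an equation. *)
Lemma flow_rule_uP q v D tu : 0 <= tu <= 1 ->
  tu *: (Vu q *m v) + (1 - tu) *: D = 0 <->
  dot (- D) v = 2 * Num.sqrt (quad (Vu q) v) * Num.sqrt (Vu_star q (- D)) /\
  (1 - tu) * Num.sqrt (Vu_star q (- D)) = tu * Num.sqrt (quad (Vu q) v).
Proof.
move=> tu01; have [C C0 HC] := V_coercive hVu.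
have := @flow_ruleP _ _ (fun=> 0) (Vu q) C (fun=> lexx 0) erefl.
move=> /(_ (fun _ _ _ => esym (mulr0 _))).
have conv0 (s : R) (x y : 'cV[R]_n) : 0 <= s <= 1 -> 0 <= s * 0 + (1 - s) * 0 :> R.
  by rewrite !mulr0 addr0.
move=> /(_ conv0 (V_sym q hVu) C0 (HC q) tu (- D) v tu01).
rewrite /contact_bound subr0 -/(Vu_star q (- D)) => <-; split=> [eq0|].
  exists 0; last by rewrite add0r scalerN opprK.
  rewrite /scale_set; case: eqP => // _; exists 0; last by rewrite scaler0.
  by move=> y; rewrite dot0l addr0.
move=> [w sw]; rewrite scalerN opprK -addrA; suff -> : w = 0 by rewrite add0r.
move: sw; rewrite /scale_set; case: eqP => // _ [w' sw <-].
suff /eqP -> : w' == 0 by rewrite scaler0.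
rewrite -dot_eq0 eq_le dot_ge0 andbT.
by have := sw (v + w'); rewrite addrAC subrr !add0r.
Qed.

Lemma flow_rule_zP q v D tz : 0 <= tz <= 1 ->
  (exists2 w, scale_set (1 - tz) (subdiff (R0 q) v) w &
     w + tz *: (Vz q *m v) + (1 - tz) *: D = 0) <->
  dot (- D) v - R0 q v =
    2 * Num.sqrt (quad (Vz q) v) * Num.sqrt (Wz_star q (- D)) /\
  (1 - tz) * Num.sqrt (Wz_star q (- D)) = tz * Num.sqrt (quad (Vz q) v).
Proof.
move=> tz01; have [C C0 HC] := V_coercive hVz.
have := @flow_ruleP _ _ (R0 q) (Vz q) C (R0_ge0 q) (R0_0 q) (@R0_hom q)
  (@R0_conv q) (V_sym q hVz) C0 (HC q) tz (- D) v tz01.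
by rewrite scalerN opprK.
Qed.

Lemma flow_conditions_M0 q tau (q' : state R n m) D tu tz : 0 <= tu <= 1 -> 0 <= tz <= 1 ->
  flow_conditions q tau q' D tu tz ->
  M0 alpha R0 Vz Vu q tau q' (- D) = (power (- D) q')%:E.
Proof.
move=> tu01 tz01 [/flow_rule_uP-/(_ tu01)[eu ru] /flow_rule_zP-/(_ tz01)[ez rz]].
move=> tau0 sw; apply/M0_eqP; split=> //.
by apply: red_potential_balance ru rz _; [exact: quad_V_ge0|exact: quad_V_ge0|
  exact: Vu_star_ge0|exact: Wz_star_ge0|].
Qed.

Lemma M0_flow_conditions q tau (q' : state R n m) D : 0 <= tau ->
  M0 alpha R0 Vz Vu q tau q' (- D) = (power (- D) q')%:E ->
  flow_conditions q tau q' D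
    (theta_u alpha (quad (Vu q) q'.1) (quad (Vz q) q'.2)
       (Vu_star q (- D.1)) (Wz_star q (- D.2)))
    (theta_z alpha (quad (Vu q) q'.1) (quad (Vz q) q'.2)
       (Vu_star q (- D.1)) (Wz_star q (- D.2))).
Proof.
move=> tau0 /M0_eqP[eu ez bal].
have a0 := quad_V_ge0 q q'.1 hVu; have b0 := quad_V_ge0 q q'.2 hVz.
have p0 := Vu_star_ge0 q (- D.1); have r0 := Wz_star_ge0 q (- D.2).
have [ru rz [tau_t sw]] := balance_switch tau0 a0 b0 p0 r0 bal.
split=> //.
  by apply/flow_rule_uP => //; exact: theta_u_ge0_le1.
by apply/flow_rule_zP => //; exact: theta_z_ge0_le1.
Qed.

End contact_potential.

(** * Differential calculus for the energy *)

Section slab_continuity.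
Context {R : realType} {n m : nat}.
Variables (T : R) (V : normedModType R) (F : R -> state R n m -> V).
Hypothesis cF : continuous_on_slab T F.

Lemma slab_cvg (X : Type) (G : set_system X) (FG : Filter G)
    (s : X -> R) (y : X -> state R n m) (s0 : R) (y0 : state R n m) :
  0 <= s0 <= T -> (\forall x \near G, 0 <= s x <= T) ->
  s x @[x --> G] --> s0 -> y x @[x --> G] --> y0 ->
  F (s x) (y x) @[x --> G] --> F s0 y0.
Proof.
move=> s0T sT cs cy.
have /(_ (s0, y0)) := (subspace_continuousP _ _).1 cF.
have s0in : (`[0, T]%classic `*` [set: state R n m]) (s0, y0) by split=> //=; rewrite in_itv.
move=> /(_ s0in) /=; apply: cvg_trans.
move=> A [/= B [B1 B2] hB].
suff : \forall x \near G, A (F (s x) (y x)) by [].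
have := cs _ B1; have := cy _ B2; rewrite !nbhs_filterE => h1 h2.
near=> x; apply: (hB (s x, y x)) => /=.
  split=> /=; first by near: x; exact: h2.
  by near: x; exact: h1.
by split=> //=; rewrite in_itv/=; near: x.
Unshelve. all: by end_near. Qed.

Lemma slab_continuous (X : topologicalType) (s : X -> R) (y : X -> state R n m) :
  (forall x, 0 <= s x <= T) -> continuous s -> continuous y ->
  continuous (fun x => F (s x) (y x)).
Proof.
move=> sT cs cy x; apply: slab_cvg => //; [|exact: cs|exact: cy].
exact: nearW.
Qed.

End slab_continuity.

Section energy_calculus.
Context {R : realType} {n m : nat}.
Variables (T : R) (E : R -> state R n m -> R).
Hypothesis hE : C1_energy T E.
Implicit Types (q v : state R n m).

Lemma derive_energy_u t q (w : 'cV[R]_n) :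
  'D_w ((fun u => E t (u, q.2)) : 'cV[R]_n -> R^o) q.1 =
  'D_(w, 0) (E t : state R n m -> R^o) q.
Proof.
rewrite /derive; apply: (congr1 (fun f : R -> R^o => lim (f @ (0 : R)^'))).
apply/funext => h /=.
by rewrite -surjective_pairing; congr (_ *: (E t (_, _) - _)); rewrite /= scaler0 add0r.
Qed.

Lemma derive_energy_z t q (w : 'cV[R]_m) :
  'D_w ((fun z => E t (q.1, z)) : 'cV[R]_m -> R^o) q.2 =
  'D_(0, w) (E t : state R n m -> R^o) q.
Proof.
rewrite /derive; apply: (congr1 (fun f : R -> R^o => lim (f @ (0 : R)^'))).
apply/funext => h /=.
by rewrite -surjective_pairing; congr (_ *: (E t (_, _) - _)); rewrite /= scaler0 add0r.
Qed.

(** The gradients collect the partial derivatives along the unit vectors, which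
    are values of the differential; linearity does the rest. *)
Lemma diff_energyE t q v : 0 <= t <= T ->
  'd (E t : state R n m -> R^o) q v = dot (Du E t q) v.1 + dot (Dz E t q) v.2.
Proof.
move=> tT; have [_ dE _ _ _] := hE; have dEq := dE t q tT.
set L := 'd _ q.
have col_sum k (w : 'cV[R]_k) : w = \sum_(i < k) w i 0 *: delta_mx i 0.
  by rewrite {1}[w]matrix_sum_delta; apply: eq_bigr => i _; rewrite big_ord1.
have Lu (u : 'cV[R]_n) : L (u, 0) = dot (Du E t q) u.
  have -> : (u, 0) = \sum_(i < n) u i 0 *: (delta_mx i 0, 0) :> state R n m.
    rewrite {1}[u]col_sum; elim/big_ind2 : _ => // [x y x' y' <- <-|i _].
      by congr pair; rewrite addr0.
    by congr pair; rewrite scaler0.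
  rewrite linear_sum/=; apply: eq_bigr => i _; rewrite linearZ/= mxE mulrC.
  by rewrite derive_energy_u deriveE.
have Lz (z : 'cV[R]_m) : L (0, z) = dot (Dz E t q) z.
  have -> : (0, z) = \sum_(i < m) z i 0 *: (0, delta_mx i 0) :> state R n m.
    rewrite {1}[z]col_sum; elim/big_ind2 : _ => // [x y x' y' <- <-|i _].
      by congr pair; rewrite addr0.
    by congr pair; rewrite scaler0.
  rewrite linear_sum/=; apply: eq_bigr => i _; rewrite linearZ/= mxE mulrC.
  by rewrite derive_energy_z deriveE.
rewrite -Lu -Lz -linearD/=; congr (L _).
by case: v => a b /=; congr pair; rewrite ?addr0 ?add0r.
Qed.

(** Near an interior time the restriction of the quotients to [[0, T]] is void. *)
Lemma Dt_is_derive t q : 0 < t < T ->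
  is_derive t 1 (fun s => E s q : R^o) (Dt T E t q).
Proof.
move=> /andP[t0 tT]; have [cvgt _ _ _ _] := hE.
have := cvgt t q; rewrite !ltW// => /(_ isT) cvg1.
have shift : (h + t) @[h --> (0:R)^'] --> within `[0, T]%classic t^'.
  move=> A /= /nbhs_ballP[e /= e0 he].
  apply/nbhs_ballP; exists (Num.min e (Num.min t (T - t))) => /=.
    by rewrite !lt_min e0 t0 subr_gt0.
  move=> h; rewrite /ball/= sub0r normrN !lt_min => /and3P[h1 h2 h3] h_neq0.
  apply: he; rewrite /ball/=.
  - by rewrite opprD addrCA subrr addr0 normrN.
  - by rewrite -subr_eq0 addrK.
  - rewrite in_itv/=; move: h2 h3; rewrite !ltr_norml; lra.
have cvgD : h^-1 *: (E (h *: 1 + t) q - E t q) @[h --> (0:R)^'] --> (Dt T E t q : R^o).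
  have := cvg_comp _ _ shift cvg1; rewrite /time_quotient.
  apply: cvg_trans; apply: near_eq_cvg; apply: nearW => h /=.
  by rewrite addrK [h *: 1]mulr1.
apply: DeriveDef; first by apply/cvg_ex; exists (Dt T E t q).
exact: (cvg_lim _ cvgD).
Qed.

Lemma energy_mvt_time t1 t2 q : 0 <= t1 <= T -> 0 <= t2 <= T ->
  exists2 s, (Num.min t1 t2 <= s <= Num.max t1 t2) &
    E t2 q - E t1 q = Dt T E s q * (t2 - t1).
Proof.
wlog le12 : t1 t2 / t1 <= t2.
  move=> H h1 h2; have [le12|/ltW le21] := leP t1 t2.
    by have := H _ _ le12 h1 h2; rewrite (min_idPl le12) (max_idPr le12).
  have [s sP e] := H _ _ le21 h2 h1; exists s.
    by move: sP; rewrite (min_idPl le21) (max_idPr le21).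
  by rewrite -opprB e -mulrN opprB.
move=> /andP[t10 t1T] /andP[t20 t2T].
rewrite (min_idPl le12) (max_idPr le12).
have [] := @MVT_segment R (fun s => E s q) (fun s => Dt T E s q) t1 t2 le12.
- move=> x; rewrite in_itv/= => /andP[x1 x2]; apply: Dt_is_derive; lra.
- apply/subspace_continuousP => x; rewrite /= in_itv/= => /andP[x1 x2].
  have [_ _ cE _ _] := hE.
  apply: (slab_cvg cE); rewrite ?(le_trans t10 x1) ?(le_trans x2 t2T)//.
  + apply: filterS (withinT _ (nbhs_filter x)) => y; rewrite /= in_itv/=; lra.
  + exact: cvg_within.
  + exact: cvg_cst.
by move=> c; rewrite in_itv/= => h1 h2; exists c.
Qed.

Lemma is_derive_comp (V : normedModType R) (f : V -> R^o) (g : R -> V) (x : R) :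
  differentiable f (g x) -> derivable g x 1 ->
  is_derive x 1 (f \o g) ('d f (g x) (derive1 g x)).
Proof.
move=> df dg; have dg' : differentiable g x by apply/derivable1_diffP.
have dfg : differentiable (f \o g) x by exact: differentiable_comp.
apply: DeriveDef; first exact: diff_derivable.
by rewrite deriveE// diff_comp//= deriv1E// scale1r.
Qed.

Lemma is_derive_line q v (x : R) :
  is_derive x 1 (fun l : R => q + l *: v) v.
Proof.
have cvgv : h^-1 *: ((q + (h *: 1 + x) *: v) - (q + x *: v)) @[h --> (0:R)^'] --> v.
  apply: cvg_near_cst; near=> h; have h0 : h != 0 by near: h; exact: nbhs_dnbhs_neq.
  rewrite scalerDl [h *: 1]mulr1 opprD addrACA subrr add0r addrK scalerA mulVf//.
  by rewrite scale1r.
apply: DeriveDef; first by apply/cvg_ex; exists v.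
exact: cvg_lim cvgv.
Unshelve. all: by end_near. Qed.

Lemma energy_mvt_space t q1 q2 : 0 <= t <= T ->
  exists2 l : R, 0 <= l <= 1 & E t q2 - E t q1 =
    dot (Du E t (q1 + l *: (q2 - q1))) (q2 - q1).1 +
    dot (Dz E t (q1 + l *: (q2 - q1))) (q2 - q1).2.
Proof.
move=> tT; pose v : state R n m := q2 - q1.
pose g (l : R) : state R n m := q1 + l *: v; rewrite -/v.
have [_ dE _ _ _] := hE.
have dEg (x : R) : is_derive x 1 ((E t : _ -> R^o) \o g) ('d (E t : _ -> R^o) (g x) v).
  have [dg <-] := is_derive_line q1 v x; rewrite -derive1E.
  by apply: is_derive_comp => //; exact: dE.
have [] := @MVT_segment R (E t \o g) (fun x => 'd (E t : _ -> R^o) (g x) v) 0 1 ler01.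
  apply: continuous_subspaceT => x; apply: differentiable_continuous.
  by apply/derivable1_diffP; case: (dEg x).
move=> l; rewrite in_itv/= => l01; rewrite /g /= scale0r scale1r addr0.
rewrite {1}/v (addrC q1) subrK subr0 mulr1 => ->; exists l => //.
by rewrite diff_energyE.
Qed.

End energy_calculus.

Lemma entry_norm_le (R : realType) (k : nat) (w : 'cV[R]_k) i : `|w i 0| <= `|w|.
Proof.
rewrite [leRHS]/Num.norm/= mx_normrE.
exact: (le_bigmax _ (fun ij : 'I_k * 'I_1 => `|w ij.1 ij.2|) (i, 0)).
Qed.

Lemma dot_norm_le (R : realType) (k : nat) (w v : 'cV[R]_k) :
  `|dot w v| <= k%:R * (`|w| * `|v|).
Proof.
apply: le_trans (ler_norm_sum _ _ _) _.
apply: (@le_trans _ _ (\sum_(i < k) `|w| * `|v|)).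
  by apply: ler_sum => i _; rewrite normrM; apply: ler_pM => //; exact: entry_norm_le.
by rewrite sumr_const card_ord mulr_natl.
Qed.

Lemma abs_cont_clamp_continuous (R : realType) (V : normedModType R) (a b : R)
  (f : R -> V) : a <= b -> abs_cont a b f -> continuous (f \o clamp a b).
Proof.
move=> ab acf x; apply/cvgrPdist_lt => e e0; have [d d0 H] := acf e e0.
have {}H u v : a <= u -> u <= v -> v <= b -> v - u < d -> `|f v - f u| < e.
  move=> au uv vb vud; have := H 1%N (fun=> u) (fun=> v).
  rewrite !big_ord1; apply=> //; by move=> i j _ _ _; rewrite !ord1.
near=> y; have xy : `|x - y| < d.
  by near: y; apply: cvgr_dist_lt => //; exact: cvg_id.
have [le_xy|/ltW le_yx] := leP x y.
  rewrite /= distrC; apply: H; [exact: clamp_ge|exact: clamp_homo|exact: clamp_le|].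
  apply: le_lt_trans (clamp_lip ab le_xy) _; apply: le_lt_trans xy.
  by rewrite distrC ler_norm.
apply: H; [exact: clamp_ge|exact: clamp_homo|exact: clamp_le|].
by apply: le_lt_trans (clamp_lip ab le_yx) _; apply: le_lt_trans xy; exact: ler_norm.
Unshelve. all: by end_near. Qed.

(** * The energy along an absolutely continuous curve *)

Section energy_along_curve.
Context {R : realType} {n m : nat}.
Variables (T S : R) (E : R -> state R n m -> R).
Variables (t : R -> R) (q : R -> state R n m).
Hypotheses (S_gt0 : 0 < S) (hE : C1_energy T E) (hAC : AC_curve T S t q).

Local Notation tc := (t \o clamp 0 S).
Local Notation qc := (q \o clamp 0 S).

Lemma tc_continuous : continuous tc.
Proof. by case: hAC => act _ _; apply: (abs_cont_clamp_continuous (ltW S_gt0) act). Qed.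

Lemma qc_continuous : continuous qc.
Proof. by case: hAC => _ acq _; apply: (abs_cont_clamp_continuous (ltW S_gt0) acq). Qed.

Lemma tc_itv s : 0 <= tc s <= T.
Proof.
by case: hAC => _ _; apply; rewrite clamp_ge clamp_le// ltW.
Qed.

Lemma along_curve_continuous (V : normedModType R) (F : R -> state R n m -> V) :
  continuous_on_slab T F -> continuous (fun s => F (tc s) (qc s)).
Proof.
move=> cF; apply: (slab_continuous cF) => //; [exact: tc_itv|exact: tc_continuous|
  exact: qc_continuous].
Qed.

Lemma T_ge0 : 0 <= T.
Proof. by have /andP[h1 h2] := tc_itv 0; exact: le_trans h2. Qed.

(** The segments joining points of the curve stay in a compact set. *)
Lemma bounded_near_curve (V : normedModType R) (F : R -> state R n m -> V) :
  continuous_on_slab T F -> exists2 L, 0 <= L &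
    forall s a b l, 0 <= s <= T -> 0 <= a <= S -> 0 <= b <= S -> 0 <= l <= 1 ->
    `|F s (q a + l *: (q b - q a))| <= L.
Proof.
move=> cF.
pose G (x : R * R * (R * R)) :=
  F (clamp 0 T x.1.1) (qc x.1.2 + x.2.2 *: (qc x.2.1 - qc x.1.2)).
have cG : continuous G.
  have c11 : continuous (fun x : R * R * (R * R) => x.1.1).
    by move=> x; apply: (cvg_comp _ _ (@cvg_fst _ _ _ _ _)); exact: cvg_fst.
  have c12 : continuous (fun x : R * R * (R * R) => x.1.2).
    by move=> x; apply: (cvg_comp _ _ (@cvg_fst _ _ _ _ _)); exact: cvg_snd.
  have c21 : continuous (fun x : R * R * (R * R) => x.2.1).
    by move=> x; apply: (cvg_comp _ _ (@cvg_snd _ _ _ _ _)); exact: cvg_fst.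
  have c22 : continuous (fun x : R * R * (R * R) => x.2.2).
    by move=> x; apply: (cvg_comp _ _ (@cvg_snd _ _ _ _ _)); exact: cvg_snd.
  have cq12 : continuous (fun x : R * R * (R * R) => qc x.1.2).
    move=> x; exact: (@continuous_comp _ _ _ (fun y => y.1.2) qc x (c12 x)
      (@qc_continuous _)).
  have cq21 : continuous (fun x : R * R * (R * R) => qc x.2.1).
    move=> x; exact: (@continuous_comp _ _ _ (fun y => y.2.1) qc x (c21 x)
      (@qc_continuous _)).
  apply: (slab_continuous cF).
  - by move=> x; rewrite clamp_ge clamp_le// T_ge0.
  - move=> x; exact: (@continuous_comp _ _ _ (fun y => y.1.1) (clamp 0 T) x (c11 x)
      (@clamp_continuous _ _ _ _)).
  - move=> x; apply: cvgD; first exact: cq12.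
    by apply: cvgZ; [exact: c22|apply: cvgB; [exact: cq21|exact: cq12]].
have cpt : compact ((`[0, T]%classic `*` `[0, S]%classic) `*`
                    (`[0, S]%classic `*` `[0, 1]%classic) : set (R * R * (R * R))).
  have c1 := compact_setX (@segment_compact R 0 T) (@segment_compact R 0 S).
  have c2 := compact_setX (@segment_compact R 0 S) (@segment_compact R 0 1).
  exact: compact_setX c1 c2.
have := compact_bounded (continuous_compact (continuous_subspaceT cG) cpt).
move=> [M [_ HM]]; exists (`|M| + 1); first by rewrite addr_ge0.
move=> s a b l sT aS bS l01; apply: (HM (`|M| + 1)).
  by rewrite ltr_pwDr// ler_norm.
exists ((s, a), (b, l)); first by split; split; rewrite /= in_itv.
by rewrite /G/= !clamp_id.
Qed.

Definition energy_curve s := E (t s) (q s).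

Lemma energy_curve_lipschitz : exists2 L, 0 < L & forall a b,
  0 <= a <= S -> 0 <= b <= S ->
  `|energy_curve b - energy_curve a| <= L * (`|t b - t a| + `|q b - q a|).
Proof.
have [_ _ _ cDt [cDu cDz]] := hE.
have [L1 L10 H1] := bounded_near_curve cDt.
have [L2 L20 H2] := bounded_near_curve cDu.
have [L3 L30 H3] := bounded_near_curve cDz.
have [_ _ tT] := hAC.
exists (L1 + (n%:R * L2 + m%:R * L3) + 1).
  by rewrite ltr_pwDr// !addr_ge0// mulr_ge0.
move=> a b aS bS; rewrite /energy_curve.
have [s sP e1] := energy_mvt_time hE (q b) (tT _ aS) (tT _ bS).
have [l l01 e2] := energy_mvt_space hE (q a) (q b) (tT _ aS).
have sT : 0 <= s <= T.
  have := tT _ aS; have := tT _ bS; move: sP.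
  by rewrite /Num.min /Num.max; case: ifP => _; lra.
have -> : E (t b) (q b) - E (t a) (q a) =
    (E (t b) (q b) - E (t a) (q b)) + (E (t a) (q b) - E (t a) (q a)) by ring.
apply: le_trans (ler_normD _ _) _; rewrite e1 e2 normrM.
have h1 : `|Dt T E s (q b)| <= L1.
  by have := H1 s b b 0 sT bS bS; rewrite scale0r addr0 lexx ler01; exact.
have h2 := H2 _ _ _ _ (tT _ aS) aS bS l01.
have h3 := H3 _ _ _ _ (tT _ aS) aS bS l01.
have g1 : `|Dt T E s (q b)| * `|t b - t a| <= L1 * `|t b - t a| by rewrite ler_wpM2r.
have g2 : `|dot (Du E (t a) (q a + l *: (q b - q a))) (q b - q a).1| <=
    n%:R * (L2 * `|q b - q a|).
  apply: le_trans (dot_norm_le _ _) _; rewrite ler_wpM2l//.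
  by apply: ler_pM => //; rewrite [leRHS]/Num.norm/= le_max lexx.
have g3 : `|dot (Dz E (t a) (q a + l *: (q b - q a))) (q b - q a).2| <=
    m%:R * (L3 * `|q b - q a|).
  apply: le_trans (dot_norm_le _ _) _; rewrite ler_wpM2l//.
  by apply: ler_pM => //; rewrite [leRHS]/Num.norm/= le_max lexx orbT.
apply: le_trans (lerD (lexx _) (ler_normD _ _)) _.
apply: le_trans (lerD g1 (lerD g2 g3)) _.
have := normr_ge0 (t b - t a); have := normr_ge0 (q b - q a).
move: `|t b - t a| `|q b - q a| => x y y0 x0.
have : 0 <= n%:R * L2 * x /\ 0 <= m%:R * L3 * x /\ 0 <= L1 * y.
  by do !split; rewrite !mulr_ge0.
nra.
Qed.

Lemma energy_curve_abs_cont : abs_cont 0 S (energy_curve : R -> R^o).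
Proof.
have [act acq _] := hAC; have [L L0 HL] := energy_curve_lipschitz.
move=> e e0; have e2 : 0 < e / (2 * L) by rewrite divr_gt0// mulr_gt0.
have [d1 d10 H1] := act _ e2; have [d2 d20 H2] := acq _ e2.
exists (Num.min d1 d2); first by rewrite lt_min d10.
move=> N x y xy tI; rewrite lt_min => /andP[/(H1 _ _ _ xy tI) h1 /(H2 _ _ _ xy tI) h2].
apply: (@le_lt_trans _ _ (L * (\sum_i `|t (y i) - t (x i)| + \sum_i `|q (y i) - q (x i)|))).
  rewrite -big_split/= mulr_sumr; apply: ler_sum => i _.
  case: (xy i) => x0 xyi yS; apply: HL; apply/andP; split=> //.
    exact: le_trans yS.
  exact: le_trans xyi.
rewrite -ltr_pdivlMl//; apply: lt_le_trans (ltrD h1 h2) _.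
by rewrite le_eqVlt; apply/orP; left; apply/eqP; field; rewrite gt_eqF.
Qed.

(** The increment is split at [E (t s) (q (h + s))]: its time part is handled by
    the mean value theorem and the continuity of [Dt T E], because the state also
    moves there; its state part is the composition of the differentiable
    [E (t s)] with the curve. *)
Lemma energy_chain_rule s : 0 < s < S -> derivable t s 1 -> derivable q s 1 ->
  derive1 energy_curve s = Dt T E (t s) (q s) * derive1 t s +
    (dot (Du E (t s) (q s)) (derive1 q s).1 +
     dot (Dz E (t s) (q s)) (derive1 q s).2).
Proof.
move=> /andP[s0 sS] dt dq.
have [_ _ tT] := hAC; have [_ dE _ cDt _] := hE.
have sT : 0 <= t s <= T by apply: tT; rewrite !ltW.
have near_itv : \forall h \near (0:R)^', 0 <= h + s <= S.
  near=> h; have : `|h| < Num.min s (S - s).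
    by near: h; apply: dnbhs0_lt; rewrite lt_min s0 subr_gt0.
  by rewrite lt_min !ltr_norml; lra.
have /choice[xi xiP] : forall h, exists x, 0 <= h + s <= S ->
    (Num.min (t s) (t (h + s)) <= x <= Num.max (t s) (t (h + s))) /\
    E (t (h + s)) (q (h + s)) - E (t s) (q (h + s)) =
      Dt T E x (q (h + s)) * (t (h + s) - t s).
  move=> h; have [hS|] := boolP (0 <= h + s <= S); last by exists 0.
  by have [x x1 x2] := energy_mvt_time hE (q (h + s)) sT (tT _ hS); exists x.
have cvgs : h + s @[h --> (0:R)^'] --> s.
  rewrite -[X in _ --> X]add0r; apply: cvgD; last exact: cvg_cst.
  exact: cvg_within.
have cvgt : t (h + s) @[h --> (0:R)^'] --> t s.
  have ct : {for s, continuous t}.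
    by apply: differentiable_continuous; exact/derivable1_diffP.
  exact: cvg_comp cvgs ct.
have cvgq : q (h + s) @[h --> (0:R)^'] --> q s.
  have cq : {for s, continuous q}.
    by apply: differentiable_continuous; exact/derivable1_diffP.
  exact: cvg_comp cvgs cq.
have cvgxi : xi h @[h --> (0:R)^'] --> t s.
  apply/cvgrPdist_lt => e e0; near=> h.
  have hS : 0 <= h + s <= S by near: h.
  have := (xiP h hS).1; have : `|t s - t (h + s)| < e.
    by near: h; exact: cvgr_dist_lt.
  rewrite !ltr_norml; case: (leP (t s) (t (h + s))); lra.
have cvgDt : Dt T E (xi h) (q (h + s)) @[h --> (0:R)^'] --> (Dt T E (t s) (q s) : R^o).
  apply: (slab_cvg cDt) => //; near=> h.
  have hS : 0 <= h + s <= S by near: h.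
  have := (xiP h hS).1; have := tT _ hS.
  by case: (leP (t s) (t (h + s))); lra.
have cvgt' : h^-1 * (t (h + s) - t s) @[h --> (0:R)^'] --> derive1 t s.
  exact: derive1_cvg dt.
have [dEq +] : is_derive s 1 ((E (t s) : _ -> R^o) \o q)
    ('d (E (t s) : _ -> R^o) (q s) (derive1 q s)).
  by apply: is_derive_comp => //; exact: dE.
rewrite -derive1E => E'.
have cvgE : h^-1 * (E (t s) (q (h + s)) - E (t s) (q s)) @[h --> (0:R)^'] -->
    (dot (Du E (t s) (q s)) (derive1 q s).1 +
     dot (Dz E (t s) (q s)) (derive1 q s).2).
  by rewrite -(diff_energyE hE)// -E'; exact: derive1_cvg dEq.
rewrite [LHS]/derive1; apply: cvg_lim => //.
apply: cvg_trans; last exact: cvgD (cvgM cvgDt cvgt') cvgE.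
apply: near_eq_cvg.
near=> h; have hS : 0 <= h + s <= S by near: h.
have := (xiP h hS).2; rewrite /energy_curve /=.
set d := Dt _ _ _ _ => eqd.
transitivity (h^-1 * (d * (t (h + s) - t s)) +
              h^-1 * (E (t s) (q (h + s)) - E (t s) (q s))); first by rewrite mulrCA.
by rewrite -eqd -mulrDr; congr (_ * _); ring.
Unshelve. all: by end_near. Qed.

End energy_along_curve.

(** * Integrals and exceptional null sets *)

Section integral_off_null_set.
Context d (T : measurableType d) (R : realType).
Variables (mu : {measure set T -> \bar R}) (N : set T).
Hypotheses (mN : measurable N) (N0 : mu N = 0%E).
Local Open Scope ereal_scope.
Import HBNNSimple.

(** The derivatives of the curve take arbitrary values on an exceptional null
    set [N], so that integrands are compared by hand: the simple functions below
    [f] are truncated to vanish on [N], which brings them below [g]. *)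
Lemma le_integral_off_null (f g : T -> \bar R) :
  (forall x, 0 <= f x) -> (forall x, 0 <= g x) ->
  (forall x, ~ N x -> f x <= g x) -> \int[mu]_x f x <= \int[mu]_x g x.
Proof.
move=> f0 g0 fg; rewrite ge0_integralTE// ge0_integralTE//.
apply: ge_ereal_sup => _ [h /= hf <-].
have mCN : measurable (~` N) by exact: measurableC.
apply: ereal_sup_ubound; exists (proj_nnsfun h mCN) => [x|].
  rewrite /= /proj_nnsfun /= mindicE; case: (pselect (N x)) => Nx.
    by rewrite memNset ?mulr0//=; apply: contrapT => -[].
  by rewrite mem_set// mulr1; exact: le_trans (hf x) (fg x Nx).
rewrite -!integralT_nnsfun.
rewrite [RHS](@ge0_negligible_integral _ _ _ mu setT N)//; last 2 first.
- by apply/measurable_EFinP.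
- by move=> x _; rewrite lee_fin.
rewrite integral_mkcond [RHS]integral_mkcond; apply: eq_integral => x _.
rewrite patch_setT setTD /patch /proj_nnsfun/= mindicE.
by case: ifP => _; rewrite ?mulr1 ?mulr0.
Qed.

Lemma eq_integral_off_null (D : set T) (f g : T -> \bar R) :
  (forall x, D x -> ~ N x -> f x = g x) ->
  \int[mu]_(x in D) f x = \int[mu]_(x in D) g x.
Proof.
move=> fg; rewrite integralE [RHS]integralE.
have patch_eq x : ~ N x -> (f \_ D) x = (g \_ D) x.
  by move=> Nx; rewrite /patch; case: ifPn => //; rewrite inE => /fg; exact.
congr (_ - _); rewrite integral_mkcond [RHS]integral_mkcond -!(funepos_restrict, funeneg_restrict).
  apply/eqP; rewrite eq_le; apply/andP; split; apply: le_integral_off_null => // x Nx;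
  by rewrite !funeposE patch_eq.
apply/eqP; rewrite eq_le; apply/andP; split; apply: le_integral_off_null => // x Nx;
by rewrite !funenegE patch_eq.
Qed.

Lemma integral_setD_null (D : set T) (f : T -> \bar R) :
  \int[mu]_(x in D) f x = \int[mu]_(x in D `\` N) f x.
Proof.
rewrite integral_mkcond [RHS]integral_mkcond; apply: eq_integral_off_null.
move=> x _ Nx; rewrite /patch; congr (if _ then _ else _).
by apply/idP/idP; rewrite !inE => // -[].
Qed.

End integral_off_null_set.

(** * Continuity and measurability tools *)

Section continuity_of_forms.
Context {R : realType}.

Lemma cvg_dot (k : nat) (X : Type) (G : set_system X) (FG : Filter G)
    (x y : X -> 'cV[R]_k) (x0 y0 : 'cV[R]_k) :
  x r @[r --> G] --> x0 -> y r @[r --> G] --> y0 ->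
  dot (x r) (y r) @[r --> G] --> dot x0 y0.
Proof.
move=> cx cy; apply: cvg_big; first exact: add_continuous.
move=> i _; apply: cvgM.
  exact: (cvg_comp _ _ cx (@coord_continuous _ _ _ i 0 x0)).
exact: (cvg_comp _ _ cy (@coord_continuous _ _ _ i 0 y0)).
Qed.

Lemma cvg_quad (k : nat) (X : Type) (G : set_system X) (FG : Filter G)
    (A : X -> 'M[R]_k) (v : X -> 'cV[R]_k) (A0 : 'M[R]_k) (v0 : 'cV[R]_k) :
  A r @[r --> G] --> A0 -> v r @[r --> G] --> v0 ->
  quad (A r) (v r) @[r --> G] --> quad A0 v0.
Proof.
move=> cA cv; apply: cvgM; first exact: cvg_cst.
have entry (B : 'M[R]_k) (w : 'cV[R]_k) :
    dot (B *m w) w = \sum_(i < k) dot ((row i B)^T) w * w i 0.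
  apply: eq_bigr => i _; rewrite mxE; congr (_ * _).
  by apply: eq_bigr => j _; rewrite !mxE.
rewrite entry; under eq_fun do rewrite entry.
apply: cvg_big; first exact: add_continuous.
move=> i _; apply: cvgM; last exact: (cvg_comp _ _ cv (@coord_continuous _ _ _ i 0 v0)).
have -> : dot ((row i A0)^T) v0 = \sum_j A0 i j * v0 j 0.
  by apply: eq_bigr => j _; rewrite !mxE.
have -> : (fun r => dot ((row i (A r))^T) (v r)) = (fun r => \sum_j A r i j * v r j 0).
  by apply/funext => r; apply: eq_bigr => j _; rewrite !mxE.
apply: cvg_big; first exact: add_continuous.
move=> j _; apply: cvgM.
  exact: (cvg_comp _ _ cA (@coord_continuous _ _ _ i j A0)).
exact: (cvg_comp _ _ cv (@coord_continuous _ _ _ j 0 v0)).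
Qed.

(** A supremum of continuous functions is lower semicontinuous. *)
Lemma measurable_conjugate (k : nat) (f : R -> 'cV[R]_k -> R) (xi : R -> 'cV[R]_k) :
  (forall v, continuous (fun r => f r v)) -> continuous xi ->
  measurable_fun setT (fun r => conjugate_fun (f r) (xi r)).
Proof.
move=> cf cxi; apply: lower_semicontinuous_measurable.
apply/lower_semicontinuousP => a.
have -> : [set r | (a%:E < conjugate_fun (f r) (xi r))%E] =
    \bigcup_v [set r | a < dot (xi r) v - f r v].
  apply/seteqP; split=> r /=.
    by move=> /ereal_sup_gt[_ [v _ <-]]; rewrite lte_fin => h; exists v.
  move=> [v _ /= h]; apply: (@lt_le_trans _ _ (dot (xi r) v - f r v)%:E).
    by rewrite lte_fin.
  by apply: ereal_sup_ubound; exists v.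
apply: bigcup_open => v _.
apply: (@open_comp _ _ (fun r => dot (xi r) v - f r v) [set x | a < x]).
  move=> r _; apply: cvgB; last exact: cf.
  by apply: cvg_dot; [exact: cxi|exact: cvg_cst].
exact: open_gt.
Qed.

Lemma measurable_fun_if_on d (Y : measurableType d) d' (Z : measurableType d')
    (D : set Y) (b : Y -> bool) (f g : Y -> Z) : measurable D ->
  measurable_fun D b -> measurable_fun D f -> measurable_fun D g ->
  measurable_fun D (fun y => if b y then f y else g y).
Proof.
move=> mD mb mf mg; apply: measurable_fun_if => //.
- by apply: measurable_funS mf => // y [].
- by apply: measurable_funS mg => // y [].
Qed.

End continuity_of_forms.

Section derivable_state.
Context {R : realType} {n m : nat}.

Lemma derivable_stateP (q : R -> state R n m) (s : R) :
  (forall i, derivable (fun r => (q r).1 i 0) s 1) ->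
  (forall j, derivable (fun r => (q r).2 j 0) s 1) -> derivable q s 1.
Proof.
move=> d1 d2; rewrite (_ : q = fun r => ((q r).1, (q r).2)); last first.
  by apply/funext => r; rewrite -surjective_pairing.
apply/derivable1_diffP/differentiable_pair; apply/derivable1_diffP.
  by apply/derivable_mxP => i j; rewrite ord1; exact: d1.
by apply/derivable_mxP => i j; rewrite ord1; exact: d2.
Qed.

Lemma abs_cont_le (V W : normedModType R) (a b : R) (f : R -> V) (g : R -> W) :
  (forall x y, `|g y - g x| <= `|f y - f x|) -> abs_cont a b f -> abs_cont a b g.
Proof.
move=> gf acf e e0; have [d d0 H] := acf e e0; exists d => // N x y xy tI xyd.
by apply: le_lt_trans (H _ _ _ xy tI xyd); apply: ler_sum => i _.
Qed.

Lemma abs_cont_derivable_ae (a b : R) (q : R -> state R n m) : a <= b ->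
  abs_cont a b q ->
  {ae @lebesgue_measure R, forall s, a < s < b -> derivable q s 1}.
Proof.
move=> ab acq.
have du i : {ae @lebesgue_measure R, forall s, a < s < b ->
    derivable (fun r => (q r).1 i 0) s 1}.
  have ac1 : abs_cont a b ((fun r => (q r).1 i 0) : R -> R^o).
    apply: (abs_cont_le _ acq) => x y.
    have -> : (q y).1 i 0 - (q x).1 i 0 = ((q y).1 - (q x).1) i 0 by rewrite !mxE.
    apply: le_trans (entry_norm_le _ _) _.
    by rewrite [leRHS]/Num.norm/= le_max lexx.
  have [h [_ _]] := ac_FTC ab ac1; apply: filterS.
    exact: (ae_filter_ringOfSetsType (@lebesgue_measure R)).
  by move=> s H sab; case: (H sab).
have dz j : {ae @lebesgue_measure R, forall s, a < s < b ->
    derivable (fun r => (q r).2 j 0) s 1}.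
  have ac1 : abs_cont a b ((fun r => (q r).2 j 0) : R -> R^o).
    apply: (abs_cont_le _ acq) => x y.
    have -> : (q y).2 j 0 - (q x).2 j 0 = ((q y).2 - (q x).2) j 0 by rewrite !mxE.
    apply: le_trans (entry_norm_le _ _) _.
    by rewrite [leRHS]/Num.norm/= le_max lexx orbT.
  have [h [_ _]] := ac_FTC ab ac1; apply: filterS.
    exact: (ae_filter_ringOfSetsType (@lebesgue_measure R)).
  by move=> s H sab; case: (H sab).
have F := ae_filter_ringOfSetsType (@lebesgue_measure R).
have H := @filterI _ _ F _ _ (filter_forall F du) (filter_forall F dz).
apply: (@filterS _ _ F _ _ _ H) => s [h1 h2] sab.
by apply: derivable_stateP => i; [exact: h1|exact: h2].
Qed.

End derivable_state.

(** * The integrated chain rule *)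

Section differentiability_set.
Context {R : realType} {n m : nat}.
Variables (T S : R) (E : R -> state R n m -> R).
Variables (t : R -> R) (q : R -> state R n m).
Hypotheses (S_gt0 : 0 < S) (hE : C1_energy T E).
Hypotheses (hAC : AC_curve T S t q) (ht : nondecreasing_on S t).
Local Notation mu := (@lebesgue_measure R).

Lemma derive1_ge0 s : 0 < s < S -> derivable t s 1 -> 0 <= derive1 t s.
Proof.
move=> /andP[s0 sS] /derive1_cvg ct; rewrite -(cvg_lim (@Rhausdorff R) ct).
apply: limr_ge; first by apply/cvg_ex; exists (derive1 t s).
near=> h; have : `|h| < Num.min s (S - s).
  by near: h; apply: dnbhs0_lt; rewrite lt_min s0 subr_gt0.
rewrite lt_min !ltr_norml => /andP[h1 h2].
have [h0|h0] := leP 0 h.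
  rewrite mulr_ge0 ?invr_ge0// subr_ge0; apply: ht; lra.
rewrite mulr_le0 ?invr_le0 ?(ltW h0)// subr_le0; apply: ht; lra.
Unshelve. all: by end_near. Qed.

(** The chain rule, integrated by [ac_FTC]. The function [pw] is an integrable
    representative of the power of the forces [- D E], with which it agrees off
    the exceptional set [N]; it is built from the densities of [t] and of the
    energy along the curve. *)
Lemma energy_identity : exists N pw,
  [/\ measurable N /\ mu N = 0%E,
      forall r, 0 <= r <= S -> ~ N r ->
        [/\ 0 < r < S, derivable t r 1, derivable q r 1, 0 <= derive1 t r &
        pw r = dot (- Du E (t r) (q r)) (derive1 q r).1 +
               dot (- Dz E (t r) (q r)) (derive1 q r).2],
      mu.-integrable `[0, S] (EFin \o pw) &
      forall s1 s2, 0 <= s1 -> s1 <= s2 -> s2 <= S ->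
        (\int[mu]_(r in `[s1, s2]) (Dt T E (t r) (q r) * derive1 t r)%:E =
         (E (t s2) (q s2) - E (t s1) (q s1))%:E +
         \int[mu]_(r in `[s1, s2]) (pw r)%:E)%E].
Proof.
have [act acq _] := hAC.
have ace := energy_curve_abs_cont S_gt0 hE hAC.
have [dt [int_dt _ ae_t]] := ac_FTC (ltW S_gt0) act.
have [de [int_de FTCe ae_e]] := ac_FTC (ltW S_gt0) ace.
have ae_q := abs_cont_derivable_ae (ltW S_gt0) acq.
have F := ae_filter_ringOfSetsType mu.
have [N0 [mN0 N00 subN0]] := @filterI _ _ F _ _ ae_t (@filterI _ _ F _ _ ae_e ae_q).
pose N := N0 `|` [set 0] `|` [set S].
have mN : measurable N.
  by apply: measurableU => //; apply: measurableU.
have muN : mu N = 0%E.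
  apply/eqP; rewrite eq_le measure_ge0 andbT.
  apply: le_trans (measureU2 _ _ _) _ => //; first exact: measurableU.
  rewrite [X in (_ + X)%E]lebesgue_measure_set1 adde0.
  apply: le_trans (measureU2 _ _ _) _ => //.
  rewrite [X in (_ + X)%E]lebesgue_measure_set1 adde0; have := N00; rewrite /= => ->; exact: lexx.
have good r : 0 <= r <= S -> ~ N r -> [/\ 0 < r < S, derivable t r 1 /\ derive1 t r = dt r,
    derive1 (energy_curve E t q) r = de r & derivable q r 1].
  move=> /andP[r0 rS] Nr; have r0S : 0 < r < S.
    rewrite !lt_neqAle r0 rS !andbT; apply/andP; split; apply/eqP => e; apply: Nr.
      by left; right.
    by right.
  have : ~ N0 r by move=> h; apply: Nr; left; left.
  move=> /(contra_not (subN0 r))/contrapT[h1 [h2 h3]].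
  by split=> //; [exact: h1|case: (h2 r0S)|exact: h3].
pose beta r := Dt T E (t (clamp 0 S r)) (q (clamp 0 S r)).
have cbeta : continuous beta.
  have [_ _ _ cDt _] := hE; exact: (along_curve_continuous S_gt0 hAC cDt).
have mS (x y : R) : measurable (`[x, y]%classic : set R) by [].
have int_bdt : mu.-integrable `[0, S] (EFin \o (fun r => dt r * beta r)).
  rewrite (_ : EFin \o _ = (EFin \o dt) \* (EFin \o beta))%E; last by apply/funext.
  apply: integrableMl => //.
  - exact: integrableS int_dt.
  - by apply: measurable_funS (continuous_measurable_fun cbeta).
  - have [M [Mreal HM]] := compact_bounded (continuous_compact
      (continuous_subspaceT cbeta) (@segment_compact R 0 S)).
    by exists M; split=> // x Mx r r0S; apply: (HM x Mx); exists r.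
exists N, (fun r => dt r * beta r - de r); split=> //.
- move=> r r0S Nr; have [r01 [dtr edt] ede dqr] := good r r0S Nr.
  split=> //; first exact: derive1_ge0.
  rewrite -edt -ede (energy_chain_rule hE hAC r01 dtr dqr) !dotNl /beta.
  by rewrite clamp_id//; ring.
- rewrite (_ : EFin \o _ = (EFin \o (fun r => (dt r * beta r)%R)) \- (EFin \o de))%E.
    by apply: integrableB => //; exact: integrableS int_de.
  by apply/funext.
move=> s1 s2 s10 s12 s2S.
have sub : `[s1, s2]%classic `<=` `[0, S]%classic.
  move=> r /=; rewrite !in_itv/= => /andP[h1 h2].
  by rewrite (le_trans s10 h1) (le_trans h2 s2S).
rewrite (@eq_integral_off_null _ _ _ mu N mN muN _ _
    (fun r => (dt r * beta r)%:E)); last first.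
  move=> r /sub; rewrite /= in_itv/= => r0S Nr.
  have [_ [_ ->] _ _] := good r r0S Nr.
  by rewrite /beta clamp_id// mulrC.
under [X in (_ + X)%E]eq_integral do rewrite EFinB.
have i1 : mu.-integrable `[s1, s2] (EFin \o (fun r => dt r * beta r)).
  exact: integrableS int_bdt.
have i2 : mu.-integrable `[s1, s2] (EFin \o de) by exact: integrableS int_de.
by rewrite integralB// FTCe// /energy_curve [RHS]addeC subeK.
Qed.

(** Through these quotients, derivatives of the curve are pointwise limits of
    continuous functions, hence measurable where they exist. *)
Lemma diff_quotient_cvg (V : normedModType R) (f : R -> V) (r : R) :
  0 < r < S -> derivable f r 1 ->
  k.+1%:R *: (f (clamp 0 S (r + k.+1%:R^-1)) - f (clamp 0 S r)) @[k --> \oo]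
    --> derive1 f r.
Proof.
move=> /andP[r0 rS] /derive1_cvg cf.
have ck : (k.+1%:R^-1 : R) @[k --> \oo] --> (0:R)^'.
  move=> A hA; have hk : \forall k \near \oo, (k.+1%:R^-1 : R) != 0 -> A k.+1%:R^-1.
    exact: (@cvg_harmonic R _ hA).
  suff : \forall k \near \oo, A (k.+1%:R^-1) by [].
  near=> k; suff : (k.+1%:R^-1 : R) != 0 -> A k.+1%:R^-1.
    by apply; rewrite invr_eq0 pnatr_eq0.
  by near: k.
have Sr : 0 < S - r by rewrite subr_gt0.
apply: cvg_trans; last exact: (cvg_comp _ _ ck cf).
apply: near_eq_cvg; near=> k => /=; rewrite invrK [r + _]addrC.
rewrite (@clamp_id _ _ _ r) ?(ltW r0) ?(ltW rS)// clamp_id//.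
rewrite addr_ge0 ?(ltW r0)//= -lerBrDr ltW//.
by near: k; exact: (near_infty_natSinv_lt (PosNum Sr)).
Unshelve. all: by end_near. Qed.

Section measurability.
Variable G : set R.
Hypothesis Gq : forall r, G r ->
  [/\ 0 < r < S, derivable t r 1 & derivable q r 1].

Lemma measurable_derive1_t : measurable_fun G (derive1 t : R -> R).
Proof.
apply: (@measurable_fun_cvg _ _ R G (fun k r =>
  k.+1%:R * (t (clamp 0 S (r + k.+1%:R^-1)) - t (clamp 0 S r)))
  (derive1 t : R -> R)); last first.
  by move=> r /Gq[r0S dt _]; exact: (@diff_quotient_cvg R^o t r r0S dt).
move=> k; apply: (@measurable_funS _ _ _ _ setT) => //.
have ct := tc_continuous S_gt0 hAC.
apply: continuous_measurable_fun => r; apply: cvgM; first exact: cvg_cst.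
apply: cvgB; last exact: ct.
have cs : {for r, continuous (fun x : R => x + k.+1%:R^-1)}.
  by apply: cvgD; [exact: cvg_id|exact: cvg_cst].
exact: (continuous_comp cs (ct _)).
Qed.

Lemma measurable_along_curve (H : state R n m -> state R n m -> R) :
  (forall p, {for p, continuous (fun p => H p.1 p.2)}) ->
  measurable_fun G (fun r => H (q r) (derive1 q r) : R).
Proof.
move=> cH; have cq := qc_continuous S_gt0 hAC.
pose dq (k : nat) r := k.+1%:R *: (q (clamp 0 S (r + k.+1%:R^-1)) - q (clamp 0 S r)).
apply: (@measurable_fun_cvg _ _ R G (fun k r => H (q (clamp 0 S r)) (dq k r))
  (fun r => H (q r) (derive1 q r) : R)).
  move=> k; apply: (@measurable_funS _ _ _ _ setT) => //.
  apply: continuous_measurable_fun => r.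
  have cdq : {for r, continuous (dq k)}.
    apply: cvgZ; first exact: cvg_cst.
    apply: cvgB; last exact: cq.
    have cs : {for r, continuous (fun x : R => x + k.+1%:R^-1)}.
      by apply: cvgD; [exact: cvg_id|exact: cvg_cst].
    exact: (continuous_comp cs (cq _)).
  have cp : {for r, continuous (fun x : R => (q (clamp 0 S x), dq k x))}.
    exact: (cvg_pair (cq r) cdq).
  exact: (continuous_comp cp (cH _)).
move=> r /Gq[r0S _ dqr].
have c1 : dq k r @[k --> \oo] --> derive1 q r by exact: diff_quotient_cvg.
have c2 : q (clamp 0 S r) @[k --> \oo] --> q r.
  by rewrite clamp_id; [exact: cvg_cst|case/andP: r0S => *; rewrite !ltW].
apply: (@cvg_comp _ _ _ (fun k => (q (clamp 0 S r), dq k r))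
  (fun p => H p.1 p.2) _ _ _ _ (cH (q r, derive1 q r))).
exact: (cvg_pair c2 c1).
Qed.

End measurability.
End differentiability_set.

(** * Measurability of the contact potential and of the parameters *)

Section measurable_potential.
Context {R : realType}.
Variables (G : set R).
Hypothesis mG : measurable G.
Implicit Types f a b p r tau : R -> R.

Lemma measurable_sqrt_on f :
  measurable_fun G f -> measurable_fun G (fun x => Num.sqrt (f x)).
Proof.
move=> mf; apply: (@measurableT_comp _ _ _ _ _ _ (Num.sqrt : R -> R)) => //.
by apply: continuous_measurable_fun; exact: sqrt_continuous.
Qed.

Lemma measurable_ratio p a : measurable_fun G p -> measurable_fun G a ->
  measurable_fun G (fun x => ratio (p x) (a x)).
Proof.
move=> mp ma; apply: (measurable_fun_if_on mG).
- by apply: measurable_fun_eqr => //; exact: measurable_cst.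
- exact: measurable_cst.
have msp := measurable_sqrt_on mp; have msa := measurable_sqrt_on ma.
apply: measurable_funM => //.
(* on nonnegative numbers the inverse is the power of exponent [-1] *)
apply: (@eq_measurable_fun _ _ _ _ _ (fun x =>
    (Num.sqrt (p x) + Num.sqrt (a x)) `^ (-1))).
  by move=> x _; rewrite powR_inv1// addr_ge0// sqrtr_ge0.
apply: (@measurableT_comp _ _ _ _ _ _ (fun y : R => y `^ (-1))).
  exact: measurable_powR.
exact: measurable_funD.
Qed.

Lemma measurable_theta_u alpha a b p r :
  measurable_fun G a -> measurable_fun G b ->
  measurable_fun G p -> measurable_fun G r ->
  measurable_fun G (fun x => theta_u alpha (a x) (b x) (p x) (r x)).
Proof.
move=> ma mb mp mr; rewrite /theta_u; case: (1 < alpha).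
  exact: measurable_ratio.
case: (alpha == 1); first by apply: measurable_ratio; exact: measurable_funD.
apply: (measurable_fun_if_on mG); first by apply: measurable_fun_eqr => //; exact: measurable_cst.
  exact: measurable_ratio.
exact: measurable_cst.
Qed.

Lemma measurable_theta_z alpha a b p r :
  measurable_fun G a -> measurable_fun G b ->
  measurable_fun G p -> measurable_fun G r ->
  measurable_fun G (fun x => theta_z alpha (a x) (b x) (p x) (r x)).
Proof.
move=> ma mb mp mr; rewrite /theta_z; case: (1 < alpha).
  apply: (measurable_fun_if_on mG).
  - by apply: measurable_fun_eqr => //; exact: measurable_cst.
  - exact: measurable_ratio.
  - exact: measurable_cst.
case: (alpha == 1); first by apply: measurable_ratio; exact: measurable_funD.
exact: measurable_ratio.
Qed.

Lemma measurable_red_potential alpha tau a b p r :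
  measurable_fun G tau -> measurable_fun G a -> measurable_fun G b ->
  measurable_fun G p -> measurable_fun G r ->
  measurable_fun G (fun x => red_potential alpha (tau x) (a x) (b x) (p x) (r x)).
Proof.
move=> mt ma mb mp mr; rewrite /red_potential.
have meq f : measurable_fun G f -> measurable_fun G (fun x => f x == 0).
  by move=> mf; apply: measurable_fun_eqr => //; exact: measurable_cst.
have mprod (f g : R -> R) : measurable_fun G f -> measurable_fun G g ->
    measurable_fun G (fun x => (2 * Num.sqrt (f x) * Num.sqrt (g x))%:E).
  move=> mf mg; apply/measurable_EFinP; apply: measurable_funM.
    by apply: measurable_funM; [exact: measurable_cst|exact: measurable_sqrt_on].
  exact: measurable_sqrt_on.
apply: (measurable_fun_if_on mG).
- by apply: measurable_fun_ltr => //; exact: measurable_cst.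
- apply: (measurable_fun_if_on mG); try exact: measurable_cst.
  by apply: measurable_and; exact: meq.
case: (1 < alpha).
  apply: (measurable_fun_if_on mG); [exact: meq|exact: mprod|].
  by apply: (measurable_fun_if_on mG); [exact: meq|exact: mprod|exact: measurable_cst].
case: (alpha == 1).
  by apply: mprod; exact: measurable_funD.
apply: (measurable_fun_if_on mG); [exact: meq|exact: mprod|].
by apply: (measurable_fun_if_on mG); [exact: meq|exact: mprod|exact: measurable_cst].
Qed.

End measurable_potential.

Section balance_along_curve.
Context {R : realType} {n m : nat}.
Variables (alpha T S : R).
Variables (R0 : state R n m -> 'cV[R]_m -> R).
Variables (Vz : state R n m -> 'M[R]_m) (Vu : state R n m -> 'M[R]_n).
Variables (E : R -> state R n m -> R).
Variables (t : R -> R) (q : R -> state R n m).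
Hypotheses (S_gt0 : 0 < S).
Hypotheses (hR0 : assumption_R0 R0) (hVz : assumption_V Vz) (hVu : assumption_V Vu).
Hypotheses (hE : C1_energy T E).
Hypotheses (hAC : AC_curve T S t q) (ht : nondecreasing_on S t).
Local Notation mu := (@lebesgue_measure R).

Let force r : state R n m := (- Du E (t r) (q r), - Dz E (t r) (q r)).
Let pot r := M0 alpha R0 Vz Vu (q r) (derive1 t r) (derive1 q r) (force r).
Let a r := quad (Vu (q r)) (derive1 q r).1.
Let b r := quad (Vz (q r)) (derive1 q r).2.
Let p r := Vu_star Vu (q r) (force r).1.
Let w r := Wz_star R0 Vz (q r) (force r).2.

Section good_set.
Variable G : set R.
Hypotheses (mG : measurable G).
Hypothesis Gq : forall r, G r ->
  [/\ 0 < r < S, derivable t r 1 & derivable q r 1].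

Let Gclamp r : G r -> clamp 0 S r = r.
Proof. by case/Gq => /andP[r0 rS] _ _; rewrite clamp_id// !ltW. Qed.

Let ma : measurable_fun G a.
Proof.
have [cVu _ _] := hVu.
apply: (measurable_along_curve S_gt0 hAC Gq (H := fun x v => quad (Vu x) v.1) _) => x.
apply: cvg_quad.
  by apply: (@continuous_comp _ _ _ fst Vu); [exact: cvg_fst|exact: cVu].
by apply: (@continuous_comp _ _ _ snd fst); [exact: cvg_snd|exact: cvg_fst].
Qed.

Let mb : measurable_fun G b.
Proof.
have [cVz _ _] := hVz.
apply: (measurable_along_curve S_gt0 hAC Gq (H := fun x v => quad (Vz x) v.2) _) => x.
apply: cvg_quad.
  by apply: (@continuous_comp _ _ _ fst Vz); [exact: cvg_fst|exact: cVz].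
by apply: (@continuous_comp _ _ _ snd snd); [exact: cvg_snd|exact: cvg_snd].
Qed.

Let mR0 : measurable_fun G (fun r => R0 (q r) (derive1 q r).2).
Proof.
have [cR0 _ _ _] := hR0.
apply: (measurable_along_curve S_gt0 hAC Gq (H := fun x v => R0 x v.2) _) => x.
apply: (@continuous_comp _ _ _ (fun y : state R n m * state R n m => (y.1, y.2.2))
  (fun y => R0 y.1 y.2)); last exact: cR0.
have c1 : {for x, continuous (fun y : state R n m * state R n m => y.1)}.
  exact: cvg_fst.
have c2 : {for x, continuous (fun y : state R n m * state R n m => y.2.2)}.
  by apply: (@continuous_comp _ _ _ snd snd); [exact: cvg_snd|exact: cvg_snd].
exact: (cvg_pair c1 c2).
Qed.

Let mp : measurable_fun G p.
Proof.
have [_ _ _ _ [cDu _]] := hE; have [cVu _ _] := hVu.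
have cq := qc_continuous S_gt0 hAC.
apply/measurable_EFinP.
apply: (@eq_measurable_fun _ _ _ _ _ (fun r => Vu_conj Vu (q (clamp 0 S r))
    (- Du E (t (clamp 0 S r)) (q (clamp 0 S r))))).
  by move=> r; rewrite inE => Gr /=; rewrite Vu_conjE// Gclamp.
apply: (@measurable_funS _ _ _ _ setT) => //.
apply: (measurable_conjugate (f := fun r => quad (Vu (q (clamp 0 S r))))).
  move=> v r; apply: cvg_quad; last exact: cvg_cst.
  exact: (continuous_comp (cq r) (cVu _)).
by move=> r; apply: cvgN; exact: (along_curve_continuous S_gt0 hAC cDu).
Qed.

Let mw : measurable_fun G w.
Proof.
have [_ _ _ _ [_ cDz]] := hE; have [cVz _ _] := hVz; have [cR0 _ _ _] := hR0.
have cq := qc_continuous S_gt0 hAC.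
apply/measurable_EFinP.
apply: (@eq_measurable_fun _ _ _ _ _ (fun r => Wz_conj R0 Vz (q (clamp 0 S r))
    (- Dz E (t (clamp 0 S r)) (q (clamp 0 S r))))).
  by move=> r; rewrite inE => Gr /=; rewrite Wz_conjE// Gclamp.
apply: (@measurable_funS _ _ _ _ setT) => //.
apply: (measurable_conjugate (f := fun r v =>
  R0 (q (clamp 0 S r)) v + quad (Vz (q (clamp 0 S r))) v)).
  move=> v r; apply: cvgD.
    have cp : {for r, continuous (fun x => (q (clamp 0 S x), v))}.
      exact: (cvg_pair (cq r) (cvg_cst _)).
    exact: (continuous_comp cp (cR0 _)).
  apply: cvg_quad; last exact: cvg_cst.
  exact: (continuous_comp (cq r) (cVz _)).
by move=> r; apply: cvgN; exact: (along_curve_continuous S_gt0 hAC cDz).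
Qed.

Lemma measurable_potential_along_curve : measurable_fun G pot.
Proof.
apply: (@eq_measurable_fun _ _ _ _ _ (fun r => (R0 (q r) (derive1 q r).2)%:E +
   red_potential alpha (derive1 t r) (a r) (b r) (p r) (w r))%E).
  by move=> r _; rewrite /pot /M0 M0_redE.
apply: emeasurable_funD; first exact/measurable_EFinP.
apply: measurable_red_potential => //; exact: (measurable_derive1_t S_gt0 hAC Gq).
Qed.

Lemma measurable_theta_along_curve :
  measurable_fun G (fun r => theta_u alpha (a r) (b r) (p r) (w r)) /\
  measurable_fun G (fun r => theta_z alpha (a r) (b r) (p r) (w r)).
Proof. by split; [exact: measurable_theta_u|exact: measurable_theta_z]. Qed.

End good_set.
End balance_along_curve.

(** * Balanced Viscosity solutions and the differential characterization *)

Section characterization.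
Context {R : realType} {n m : nat}.
Variables (alpha T S : R).
Variables (R0 : state R n m -> 'cV[R]_m -> R).
Variables (Vz : state R n m -> 'M[R]_m) (Vu : state R n m -> 'M[R]_n).
Variables (E : R -> state R n m -> R).
Variables (t : R -> R) (q : R -> state R n m).
Hypotheses (S_gt0 : 0 < S).
Hypotheses (hR0 : assumption_R0 R0) (hVz : assumption_V Vz) (hVu : assumption_V Vu).
Hypotheses (hE : C1_energy T E).
Hypotheses (hAC : AC_curve T S t q) (ht : nondecreasing_on S t).
Local Notation mu := (@lebesgue_measure R).

Let force r : state R n m := (Du E (t r) (q r), Dz E (t r) (q r)).
Let flow r := flow_conditions alpha R0 Vz Vu (q r) (derive1 t r) (derive1 q r) (force r).

(** Off a null set the flow conditions identify [M0] with the power. *)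
Lemma flow_imp_BV_solution (tu tz : R -> R) :
  (forall s, 0 <= s <= S -> 0 <= tu s <= 1) ->
  (forall s, 0 <= s <= S -> 0 <= tz s <= 1) ->
  {ae mu, forall s, 0 < s < S -> flow s (tu s) (tz s)} ->
  BV_solution alpha T S R0 Vz Vu E t q.
Proof.
move=> tu01 tz01 [N2 [mN2 N20 subN2]]; split=> // s1 s2 s10 s12 s2S.
have [N [pw [[mN N0] good int_pw balE]]] := energy_identity S_gt0 hE hAC ht.
have mNN : measurable (N `|` N2) by exact: measurableU.
have NN0 : mu (N `|` N2) = 0%E.
  apply/eqP; rewrite eq_le measure_ge0 andbT.
  apply: le_trans (measureU2 _ _ _) _ => //.
  by have := N0; have := N20; rewrite /= => -> ->; rewrite adde0.
rewrite balE// [RHS]addeA -EFinD subrKC; congr (_ + _)%E.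
apply: (eq_integral_off_null mNN NN0) => r /=; rewrite in_itv/= => /andP[sr1 sr2].
move=> Nr; have r0S : 0 <= r <= S.
  by rewrite (le_trans s10 sr1) (le_trans sr2 s2S).
have [r01 dt dq dt0 ->] : [/\ 0 < r < S, derivable t r 1, derivable q r 1,
    0 <= derive1 t r & pw r = dot (- Du E (t r) (q r)) (derive1 q r).1 +
    dot (- Dz E (t r) (q r)) (derive1 q r).2].
  by apply: good => // h; apply: Nr; left.
have fl : flow r (tu r) (tz r).
  have : ~ N2 r by move=> h; apply: Nr; right.
  by move=> /(contra_not (subN2 r))/contrapT; exact.
exact: (flow_conditions_M0 hR0 hVz hVu (tu01 r r0S) (tz01 r r0S) fl).
Qed.

(** By [M0_ge], [M0] exceeds the power off a null set, while the balance on
    [[0, S]] gives both the same finite integral; so they agree almost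
    everywhere. *)
Lemma BV_solution_imp_flow : BV_solution alpha T S R0 Vz Vu E t q ->
  exists tu tz : R -> R,
    [/\ measurable_fun `[0, S]%classic tu, measurable_fun `[0, S]%classic tz,
        forall s, 0 <= s <= S -> 0 <= tu s <= 1,
        forall s, 0 <= s <= S -> 0 <= tz s <= 1 &
        {ae mu, forall s, 0 < s < S -> flow s (tu s) (tz s)}].
Proof.
move=> [_ _ bal].
have [N [pw [[mN N0] good int_pw balE]]] := energy_identity S_gt0 hE hAC ht.
have m0S : measurable (`[0, S]%classic : set R) by [].
pose G : set R := `[0, S]%classic `\` N.
have mG : measurable G by exact: measurableD.
have Ggood r : G r -> [/\ 0 < r < S, derivable t r 1, derivable q r 1,
    0 <= derive1 t r & pw r = dot (- Du E (t r) (q r)) (derive1 q r).1 +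
    dot (- Dz E (t r) (q r)) (derive1 q r).2].
  by move=> [/=]; rewrite in_itv/= => r0S Nr; exact: good.
have Gq r : G r -> [/\ 0 < r < S, derivable t r 1 & derivable q r 1].
  by move=> /Ggood[].
pose pot r := M0 alpha R0 Vz Vu (q r) (derive1 t r) (derive1 q r)
  (- Du E (t r) (q r), - Dz E (t r) (q r)).
pose a r := quad (Vu (q r)) (derive1 q r).1.
pose b r := quad (Vz (q r)) (derive1 q r).2.
pose p r := Vu_star Vu (q r) (- Du E (t r) (q r)).
pose w r := Wz_star R0 Vz (q r) (- Dz E (t r) (q r)).
have a0 r : 0 <= a r by exact: quad_V_ge0.
have b0 r : 0 <= b r by exact: quad_V_ge0.
have p0 r : 0 <= p r by exact: Vu_star_ge0.
have w0 r : 0 <= w r by exact: Wz_star_ge0.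
have mpot : measurable_fun G pot.
  exact: (measurable_potential_along_curve alpha S_gt0 hR0 hVz hVu hE hAC mG Gq).
have [mtu mtz] : measurable_fun G (fun r => theta_u alpha (a r) (b r) (p r) (w r)) /\
    measurable_fun G (fun r => theta_z alpha (a r) (b r) (p r) (w r)).
  exact: (measurable_theta_along_curve alpha S_gt0 hR0 hVz hVu hE hAC mG Gq).
have GS : `[0, S]%classic `&` G = G by rewrite /G setDE setIA setIid.
exists ((fun r => theta_u alpha (a r) (b r) (p r) (w r)) \_ G),
  ((fun r => theta_z alpha (a r) (b r) (p r) (w r)) \_ G); split.
- by apply/(measurable_restrict _ mG m0S); rewrite GS.
- by apply/(measurable_restrict _ mG m0S); rewrite GS.
- move=> s _; rewrite /patch; case: ifP => _; last by rewrite lexx ler01.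
  exact: theta_u_ge0_le1.
- move=> s _; rewrite /patch; case: ifP => _; last by rewrite lexx ler01.
  exact: theta_z_ge0_le1.
have pot_ge r : G r -> ((pw r)%:E <= pot r)%E.
  by move=> /Ggood[_ _ _ _ ->]; exact: (M0_ge alpha hR0 hVz hVu).
have pot_ge0 r : (0 <= pot r)%E.
  rewrite /pot /M0 M0_redE// adde_ge0// ?lee_fin ?R0_ge0//.
  apply: le_trans (red_potential_ge _ _ (a0 r) (b0 r) (p0 r) (w0 r)).
  by rewrite lee_fin /balance addr_ge0// !mulr_ge0// sqrtr_ge0.
have int_pwG : mu.-integrable G (EFin \o pw).
  by apply: integrableS int_pw => // r [].
have potE : (\int[mu]_(r in G) pot r = \int[mu]_(r in G) (pw r)%:E)%E.
  rewrite -!(integral_setD_null mN N0).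
  have := bal 0 S (lexx 0) (ltW S_gt0) (lexx S).
  rewrite balE ?(ltW S_gt0)// [in RHS]addeA -EFinD subrKC.
  move=> /(congr1 (fun x => x - (E (t S) (q S))%:E)%E).
  by rewrite ![((E _ _)%:E + _)%E]addeC !addeK.
have int_pot : mu.-integrable G pot.
  apply/integrableP; split=> //.
  under eq_integral do rewrite gee0_abs//.
  rewrite potE ltey_eq; apply/orP; left.
  exact: integrable_fin_num.
have mdiff : measurable_fun G (fun r => pot r - (pw r)%:E)%E.
  by apply: emeasurable_funB => //; exact: measurable_int int_pwG.
have : ae_eq mu G (fun r => pot r - (pw r)%:E)%E (cst 0%E).
  apply/ae_eq_integral_abs => //.
  transitivity (\int[mu]_(r in G) (pot r - (pw r)%:E))%E.
    apply: eq_integral => r; rewrite inE => Gr; rewrite gee0_abs// sube_ge0//.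
    exact: pot_ge.
  by rewrite integralB// potE subee// integrable_fin_num.
move=> [N3 [mN3 N30 subN3]].
exists (N `|` N3); split; first exact: measurableU.
  apply/eqP; rewrite eq_le measure_ge0 andbT.
  apply: le_trans (measureU2 _ _ _) _ => //.
  by have := N0; have := N30; rewrite /= => -> ->; rewrite adde0.
move=> r /= nflow; apply: contrapT => Nr; apply: nflow => r0S.
have Gr : G r.
  split; first by rewrite /= in_itv/=; case/andP: r0S => *; rewrite !ltW.
  by move=> h; apply: Nr; left.
have [_ _ _ dt0 pwE] := Ggood r Gr.
have diff0 : (pot r - (pw r)%:E = 0)%E.
  have : ~ N3 r by move=> h; apply: Nr; right.
  by move=> /(contra_not (subN3 r))/contrapT; exact.
have potr : pot r = (pw r)%:E.
  by move: diff0; case: (pot r) => [x| |]//= [/eqP]; rewrite subr_eq0 => /eqP->.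
rewrite /patch mem_set//; apply: (M0_flow_conditions hR0 hVz hVu dt0).
by rewrite -/(pot r) potr pwE.
Qed.

End characterization.

Theorem theorem5p3 (R : realType) (n m : nat) (alpha T S : R)
  (R0 : state R n m -> 'cV[R]_m -> R)
  (Vz : state R n m -> 'M[R]_m) (Vu : state R n m -> 'M[R]_n)
  (E : R -> state R n m -> R)
  (t : R -> R) (q : R -> state R n m)
  (alpha_gt0 : 0 < alpha) (T_gt0 : 0 < T) (S_gt0 : 0 < S)
  (hR0 : assumption_R0 R0) (hVz : assumption_V Vz) (hVu : assumption_V Vu)
  (hE : assumption_E T E)
  (hAC : AC_curve T S t q) (ht : nondecreasing_on S t) :
  (BV_solution alpha T S R0 Vz Vu E t q /\ non_degenerate S t q)
  <->
  (non_degenerate S t q /\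
   exists theta_u theta_z : R -> R,
     [/\ measurable_fun `[0, S]%classic theta_u,
         measurable_fun `[0, S]%classic theta_z,
         forall s, 0 <= s <= S -> 0 <= theta_u s <= 1,
         forall s, 0 <= s <= S -> 0 <= theta_z s <= 1 &
         {ae @lebesgue_measure R, forall s : R, 0 < s < S ->
           [/\ theta_u s *: (Vu (q s) *m (derive1 q s).1)
                 + (1 - theta_u s) *: Du E (t s) (q s) = 0,
               exists2 w : 'cV[R]_m,
                 scale_set (1 - theta_z s) (subdiff (R0 (q s)) (derive1 q s).2) w &
                 w + theta_z s *: (Vz (q s) *m (derive1 q s).2)
                   + (1 - theta_z s) *: Dz E (t s) (q s) = 0,
               derive1 t s * theta_u s = 0 /\ derive1 t s * theta_z s = 0 &
               [/\ 1 < alpha -> theta_u s * (1 - theta_z s) = 0,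
                   alpha = 1 -> theta_u s = theta_z s &
                   alpha < 1 -> theta_z s * (1 - theta_u s) = 0]]}]).
Proof.
split=> [[sol nd]|[nd [tu [tz [mtu mtz tu01 tz01 fl]]]]].
  split=> //; have [hE1 _ _ _] := hE.
  exact: (BV_solution_imp_flow S_gt0 hR0 hVz hVu hE1 hAC ht sol).
split=> //; have [hE1 _ _ _] := hE.
exact: (flow_imp_BV_solution S_gt0 hR0 hVz hVu hE1 hAC ht tu01 tz01 fl).
Qed.
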